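(* Let $\lambda$ be a cardinal and $\gamma<\lambda$ a limit ordinal. The algebra $(\mathcal{E}_\lambda/{\equiv^\gamma},* )$ is a permutative LD-system, and $\mathrm{Li}(\mathcal{E}_\lambda/{\equiv^\gamma})=\{[1_{V_\lambda}]_\gamma\}$.
   Context: $\mathcal{E}_\lambda$ is the set of all elementary embeddings $j:V_\lambda\to V_\lambda$ with the application operation $j*k=\bigcup_{\alpha<\lambda}j(k|_{V_\alpha})$, which is an LD-system: $x*(y*z)=(x*y)*(x*z)$. For a limit ordinal $\gamma<\lambda$, $j\equiv^\gamma k$ means $j(x)\cap V_\gamma=k(x)\cap V_\gamma$ for all $x\in V_\gamma$; this is a congruence on $(\mathcal{E}_\lambda,* )$, and $[j]_\gamma$ denotes the class of $j$. For an LD-system $X$, $\mathrm{Li}(X)$ is the set of all $x\in X$ with $x*y=y$ for all $y\in X$. A left-ideal is a subset $I$ with $y\in I\Rightarrow x*y\in I$ for all $x\in X$. The Fibonacci terms are $t_1(x,y)=y$, $t_2(x,y)=x$, $t_{n+2}(x,y)=t_{n+1}(x,y)*t_n(x,y)$. $X$ is permutative if $\mathrm{Li}(X)$ is a left-ideal and for all $x,y\in X$ there is $n\ge1$ with $t_n(x,y)\in\mathrm{Li}(X)$. The Laver–Steel theorem may be assumed known: if $j_n\in\mathcal{E}_\lambda$ is non-trivial for each $n\in\omega$, then $\sup_n\mathrm{crit}((\cdots(j_0*j_1)*\cdots)*j_n)=\lambda$. *)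

(* Defs.v *)
From Stdlib Require Import ClassicalEpsilon FunctionalExtensionality
  PropExtensionality ProofIrrelevance.

(** * The universe of sets

    [V] is Aczel's cumulative hierarchy: well-founded trees modulo bisimulation,
    represented by their bisimulation classes so that equality of sets is
    Leibniz equality.  In classical logic with choice it satisfies ZFC
    (with replacement and separation for arbitrary predicates). *)

Inductive tree : Type := node (I : Type) (f : I -> tree).

Fixpoint bisim (s t : tree) : Prop :=
  match s, t with
  | node A f, node B g =>
      (forall i, exists j, bisim (f i) (g j)) /\
      (forall j, exists i, bisim (f i) (g j))
  end.

Definition V : Type := {C : tree -> Prop | exists t, C = bisim t}.

Definition of_tree (t : tree) : V := exist _ (bisim t) (ex_intro _ t eq_refl).

Definition mem (x y : V) : Prop :=
  exists (I : Type) (f : I -> tree) (i : I),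
    y = of_tree (node I f) /\ x = of_tree (f i).

Notation "x ∈ y" := (mem x y) (at level 70, no associativity).

Definition subset (x y : V) : Prop := forall z, z ∈ x -> z ∈ y.

Lemma bisim_refl t : bisim t t.
Proof. induction t as [I f IH]; simpl; split; intro i; exists i; apply IH. Qed.

Lemma bisim_sym s t : bisim s t -> bisim t s.
Proof.
revert t; induction s as [I f IH]; intros [J g] [H1 H2]; simpl; split.
- intro j; destruct (H2 j) as [i Hi]; exists i; apply IH, Hi.
- intro i; destruct (H1 i) as [j Hj]; exists j; apply IH, Hj.
Qed.

Lemma bisim_trans s t u : bisim s t -> bisim t u -> bisim s u.
Proof.
revert t u; induction s as [I f IH]; intros [J g] [K h] [H1 H2] [H3 H4].
simpl; split.
- intro i; destruct (H1 i) as [j Hj]; destruct (H3 j) as [k Hk].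
  exists k; eapply IH; eauto.
- intro k; destruct (H4 k) as [j Hj]; destruct (H2 j) as [i Hi].
  exists i; eapply IH; eauto.
Qed.

Lemma of_tree_eq s t : of_tree s = of_tree t <-> bisim s t.
Proof.
split.
- intro H; apply (f_equal (@proj1_sig _ _)) in H; simpl in H.
  rewrite H; apply bisim_refl.
- intro H; apply subset_eq_compat, functional_extensionality; intro u.
  apply propositional_extensionality; split; intro Hu.
  + exact (bisim_trans _ _ _ (bisim_sym _ _ H) Hu).
  + exact (bisim_trans _ _ _ H Hu).
Qed.

Lemma of_tree_surj (x : V) : exists t, x = of_tree t.
Proof.
destruct x as [C [t Ht]]; exists t; apply subset_eq_compat; exact Ht.
Qed.

Lemma mem_node x I (f : I -> tree) :
  x ∈ of_tree (node I f) <-> exists i, x = of_tree (f i).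
Proof.
split.
- intros (J & g & j & E & ->); apply of_tree_eq in E; destruct E as [_ E].
  destruct (E j) as [i Hi]; exists i; symmetry; apply of_tree_eq, Hi.
- intros [i ->]; exists I, f, i; split; reflexivity.
Qed.

Lemma V_ext (x y : V) : (forall z, z ∈ x <-> z ∈ y) -> x = y.
Proof.
destruct (of_tree_surj x) as [[I f] ->], (of_tree_surj y) as [[J g] ->]; intro H.
apply of_tree_eq; simpl; split.
- intro i; destruct (proj1 (mem_node (of_tree (f i)) J g)) as [j Hj].
  { apply H, mem_node; exists i; reflexivity. }
  exists j; apply of_tree_eq, Hj.
- intro j; destruct (proj1 (mem_node (of_tree (g j)) I f)) as [i Hi].
  { apply H, mem_node; exists j; reflexivity. }
  exists i; apply of_tree_eq; symmetry; exact Hi.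
Qed.

Lemma mem_wf : well_founded mem.
Proof.
intro x; destruct (of_tree_surj x) as [t ->]; induction t as [I f IH].
constructor; intros y Hy; apply mem_node in Hy; destruct Hy as [i ->]; apply IH.
Qed.

Lemma family_set (I : Type) (f : I -> V) :
  exists s, forall x, x ∈ s <-> exists i, x = f i.
Proof.
pose (r := fun i => constructive_indefinite_description _ (of_tree_surj (f i))).
exists (of_tree (node I (fun i => proj1_sig (r i)))); intro x.
rewrite mem_node; split; intros [i ->]; exists i;
  [symmetry|]; exact (proj2_sig (r i)).
Qed.

Lemma set_family (s : V) :
  exists (I : Type) (f : I -> V), forall x, x ∈ s <-> exists i, x = f i.
Proof.
destruct (of_tree_surj s) as [[I f] ->].
exists I, (fun i => of_tree (f i)); intro x; apply mem_node.
Qed.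

(** [setof P] is the set {x | P x}; it is meaningful only if the class [P]
    is a set. *)
Definition is_set (P : V -> Prop) : Prop := exists s, forall x, x ∈ s <-> P x.

Definition empty : V := of_tree (node Empty_set (fun i => match i with end)).

Definition setof (P : V -> Prop) : V :=
  epsilon (inhabits empty) (fun s => forall x, x ∈ s <-> P x).

Lemma setofP P : is_set P -> forall x, x ∈ setof P <-> P x.
Proof. exact (epsilon_spec (inhabits empty) _). Qed.

Lemma is_set_family (I : Type) (f : I -> V) : is_set (fun x => exists i, x = f i).
Proof. exact (family_set I f). Qed.

Lemma is_set_sub (s : V) (P : V -> Prop) : (forall x, P x -> x ∈ s) -> is_set P.
Proof.
intro HP; destruct (set_family s) as (I & f & Hf).
destruct (family_set {i : I | P (f i)} (fun u => f (proj1_sig u))) as [t Ht].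
exists t; intro x; rewrite Ht; split.
- intros [[i Hi] ->]; exact Hi.
- intro Hx; destruct (proj1 (Hf x) (HP x Hx)) as [i ->].
  exists (exist _ i Hx); reflexivity.
Qed.

Lemma is_set_union (s : V) (F : V -> V -> Prop) :
  (forall y, y ∈ s -> is_set (F y)) -> is_set (fun x => exists y, y ∈ s /\ F y x).
Proof.
intro H; destruct (set_family s) as (I & f & Hf).
assert (G : forall i, exists Jg : {J : Type & J -> V},
          forall x, F (f i) x <-> exists j, x = projT2 Jg j).
{ intro i; destruct (H (f i)) as [t Ht]; [apply Hf; exists i; reflexivity|].
  destruct (set_family t) as (J & g & Hg); exists (existT _ J g); intro x.
  rewrite <- Ht; apply Hg. }
pose (c := fun i => constructive_indefinite_description _ (G i)).
destruct (family_set {i : I & projT1 (proj1_sig (c i))}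
            (fun u => projT2 (proj1_sig (c (projT1 u))) (projT2 u))) as [u Hu].
exists u; intro x; rewrite Hu; split.
- intros [[i j] ->]; exists (f i); split; [apply Hf; exists i; reflexivity|].
  apply (proj2_sig (c i)); exists j; reflexivity.
- intros [y [Hy Hx]]; destruct (proj1 (Hf y) Hy) as [i ->].
  destruct (proj1 (proj2_sig (c i) x) Hx) as [j Hj].
  exists (existT _ i j); exact Hj.
Qed.

Lemma is_set_power (s : V) : is_set (fun x => subset x s).
Proof.
destruct (set_family s) as (I & f & Hf).
destruct (family_set (I -> Prop) (fun P => setof (fun x => exists i, P i /\ x = f i)))
  as [t Ht].
assert (S : forall P : I -> Prop, forall x,
  x ∈ setof (fun x => exists i, P i /\ x = f i) <-> exists i, P i /\ x = f i).
{ intro P; apply setofP, (is_set_sub s); intros x [i [_ ->]].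
  apply Hf; exists i; reflexivity. }
exists t; intro x; rewrite Ht; split.
- intros [P ->] z Hz; apply S in Hz; destruct Hz as [i [_ ->]].
  apply Hf; exists i; reflexivity.
- intro Hx; exists (fun i => f i ∈ x); apply V_ext; intro z; rewrite S; split.
  + intro Hz; destruct (proj1 (Hf z) (Hx z Hz)) as [i ->].
    exists i; split; [exact Hz|reflexivity].
  + intros [i [Hi ->]]; exact Hi.
Qed.

(** * Pairs and functions *)

Definition upair (x y : V) : V := setof (fun z => z = x \/ z = y).

Definition opair (x y : V) : V := upair (upair x x) (upair x y).

Lemma upairP x y z : z ∈ upair x y <-> z = x \/ z = y.
Proof.
apply (setofP (fun z => z = x \/ z = y)).
destruct (family_set bool (fun b => if b then x else y)) as [s Hs].
exists s; intro w; rewrite Hs; split.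
- intros [[|] ->]; [left|right]; reflexivity.
- intros [->| ->]; [exists true|exists false]; reflexivity.
Qed.

Lemma opair_inj x y x' y' : opair x y = opair x' y' -> x = x' /\ y = y'.
Proof.
intro H.
assert (M : forall z, z = upair x x \/ z = upair x y <->
                      z = upair x' x' \/ z = upair x' y').
{ intro z; unfold opair in H; rewrite <- !upairP, H; reflexivity. }
assert (U : forall a b c, upair a b = upair c c -> a = c /\ b = c).
{ intros a b c E; split.
  - assert (W : a ∈ upair c c) by (rewrite <- E; apply upairP; auto).
    apply upairP in W; tauto.
  - assert (W : b ∈ upair c c) by (rewrite <- E; apply upairP; auto).
    apply upairP in W; tauto. }
assert (X : x = x').
{ destruct (proj1 (M (upair x x)) (or_introl eq_refl)) as [E|E].
  - exact (proj1 (U _ _ _ E)).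
  - symmetry; exact (proj1 (U _ _ _ (eq_sym E))). }
subst x'; split; [reflexivity|].
destruct (proj1 (M (upair x y)) (or_intror eq_refl)) as [E|E].
- destruct (U _ _ _ E) as [_ ->].
  destruct (proj2 (M (upair x y')) (or_intror eq_refl)) as [E'|E'];
    symmetry; exact (proj2 (U _ _ _ E')).
- assert (Y : y ∈ upair x y') by (rewrite <- E; apply upairP; auto).
  assert (Y' : y' ∈ upair x y) by (rewrite E; apply upairP; auto).
  apply upairP in Y, Y'; destruct Y, Y'; congruence.
Qed.

Definition inter (x y : V) : V := setof (fun z => z ∈ x /\ z ∈ y).

Definition is_function (f A B : V) : Prop :=
  (forall z, z ∈ f -> exists x y, x ∈ A /\ y ∈ B /\ z = opair x y) /\
  (forall x, x ∈ A -> exists! y, opair x y ∈ f).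

Definition ap (f x : V) : V := epsilon (inhabits empty) (fun y => opair x y ∈ f).

Definition restrict (f A : V) : V :=
  setof (fun z => z ∈ f /\ exists x y, x ∈ A /\ z = opair x y).

Definition identity (A : V) : V := setof (fun z => exists x, x ∈ A /\ z = opair x x).

Definition is_bijection (f A B : V) : Prop :=
  is_function f A B /\ forall y, y ∈ B -> exists! x, opair x y ∈ f.

(** * Ordinals, cardinals and the sets V_a *)

Definition transitive (x : V) : Prop := forall y, y ∈ x -> subset y x.

(** Well-foundedness of [mem] makes this equivalent to "transitive and
    well-ordered by membership". *)
Definition ordinal (a : V) : Prop :=
  transitive a /\ forall b, b ∈ a -> transitive b.

Definition limit_ordinal (a : V) : Prop :=
  ordinal a /\ (exists b, b ∈ a) /\ forall b, b ∈ a -> exists c, c ∈ a /\ b ∈ c.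

Definition cardinal (a : V) : Prop :=
  ordinal a /\ forall b, b ∈ a -> ~ exists f, is_bijection f b a.

(** V_a is the union of the power sets of the V_b for b in a. *)
Inductive in_stage : V -> V -> Prop :=
| in_stage_intro a b x :
    b ∈ a -> (forall y, y ∈ x -> in_stage b y) -> in_stage a x.

Definition stage (a : V) : V := setof (in_stage a).

Lemma stageP a x : x ∈ stage a <-> exists b, b ∈ a /\ subset x (stage b).
Proof.
assert (S : forall a, is_set (in_stage a)).
{ intro a'; induction a' as [c IH] using (well_founded_induction mem_wf).
  destruct (is_set_union c (fun b x => subset x (stage b))) as [t Ht].
  { intros b _; apply is_set_power. }
  exists t; intro z; rewrite Ht; split.
  - intros [b [Hb Hz]]; apply (in_stage_intro c b z Hb); intros y Hy.
    apply (setofP _ (IH b Hb)), Hz, Hy.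
  - intro Hz; inversion Hz as [c' b z' Hb H]; subst; exists b; split; [exact Hb|].
    intros y Hy; apply (setofP _ (IH b Hb)), H, Hy. }
unfold stage at 1; rewrite (setofP _ (S a)); split.
- intro H; inversion H as [a' b x' Hb K]; subst; exists b; split; [exact Hb|].
  intros y Hy; apply (setofP _ (S b)), K, Hy.
- intros [b [Hb H]]; apply (in_stage_intro a b x Hb); intros y Hy.
  apply (setofP _ (S b)), H, Hy.
Qed.

(** * Elementary embeddings *)

(** First-order formulas in the language of set theory, with de Bruijn
    variables. *)
Inductive formula : Type :=
| fMem (m n : nat)
| fEq (m n : nat)
| fFalse
| fImp (p q : formula)
| fAll (p : formula).

Definition scons (x : V) (e : nat -> V) (n : nat) : V :=
  match n with O => x | S m => e m end.

(** Satisfaction in the structure (M, ∈). *)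
Fixpoint sat (M : V) (p : formula) (e : nat -> V) : Prop :=
  match p with
  | fMem m n => e m ∈ e n
  | fEq m n => e m = e n
  | fFalse => False
  | fImp p q => sat M p e -> sat M q e
  | fAll p => forall x, x ∈ M -> sat M p (scons x e)
  end.

Definition elementary_embedding (f M N : V) : Prop :=
  is_function f M N /\
  forall (p : formula) (e : nat -> V), (forall n, e n ∈ M) ->
    (sat M p e <-> sat N p (fun n => ap f (e n))).

Definition Emb (lam j : V) : Prop :=
  elementary_embedding j (stage lam) (stage lam).

Definition app (lam j k : V) : V :=
  setof (fun z => exists a, a ∈ lam /\ z ∈ ap j (restrict k (stage a))).

Definition agree (gam j k : V) : Prop :=
  forall x, x ∈ stage gam ->
    inter (ap j x) (stage gam) = inter (ap k x) (stage gam).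

Definition is_crit (lam j kap : V) : Prop :=
  kap ∈ lam /\ ap j kap <> kap /\ forall a, a ∈ kap -> ap j a = a.

Definition crit (lam j : V) : V := epsilon (inhabits empty) (is_crit lam j).

(** [left_power lam j n] is (...(j 0 * j 1) * ...) * j n. *)
Fixpoint left_power (lam : V) (j : nat -> V) (n : nat) : V :=
  match n with
  | O => j O
  | S m => app lam (left_power lam j m) (j (S m))
  end.

(** The supremum of a set of ordinals is its union. *)
Definition sup_seq (f : nat -> V) : V := setof (fun x => exists n, x ∈ f n).

Definition laver_steel (lam : V) : Prop :=
  forall j : nat -> V,
    (forall n, Emb lam (j n) /\ j n <> identity (stage lam)) ->
    sup_seq (fun n => crit lam (left_power lam j n)) = lam.

(** * LD-systems, given by a carrier [X] inside a type [T] and an operation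
    that is required to preserve [X] *)

Definition LD_system {T : Type} (X : T -> Prop) (op : T -> T -> T) : Prop :=
  (forall x y, X x -> X y -> X (op x y)) /\
  (forall x y z, X x -> X y -> X z ->
     op x (op y z) = op (op x y) (op x z)).

Definition Li {T : Type} (X : T -> Prop) (op : T -> T -> T) (x : T) : Prop :=
  X x /\ forall y, X y -> op x y = y.

Definition left_ideal {T : Type} (X : T -> Prop) (op : T -> T -> T)
    (I : T -> Prop) : Prop :=
  (forall y, I y -> X y) /\ forall x y, X x -> I y -> I (op x y).

(** The terms are indexed from 1; the value at 0 is a dummy. *)
Fixpoint fib_term {T : Type} (op : T -> T -> T) (n : nat) (x y : T) : T :=
  match n with
  | O => y
  | S m =>
      match m with
      | O => y
      | S O => x
      | S p => op (fib_term op m x y) (fib_term op p x y)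
      end
  end.

Definition permutative {T : Type} (X : T -> Prop) (op : T -> T -> T) : Prop :=
  left_ideal X op (Li X op) /\
  forall x y, X x -> X y -> exists n, 1 <= n /\ Li X op (fib_term op n x y).

(** Quotient of a carrier [X] by a relation [R]: its elements are the classes,
    and the product of two classes consists of everything related to a product
    of representatives.  The quotient is closed under this product when [R] is
    a congruence. *)

Definition eq_class {T : Type} (X : T -> Prop) (R : T -> T -> Prop) (x : T) :
    T -> Prop :=
  fun y => X y /\ R x y.

Definition quot {T : Type} (X : T -> Prop) (R : T -> T -> Prop) :
    (T -> Prop) -> Prop :=
  fun C => exists x, X x /\ C = eq_class X R x.

Definition quot_op {T : Type} (X : T -> Prop) (R : T -> T -> Prop)
    (op : T -> T -> T) (A B : T -> Prop) : T -> Prop :=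
  fun z => X z /\ exists a b, A a /\ B b /\ R (op a b) z.

(* Main.v *)
Require Import Defs.
From Stdlib Require Import Classical ClassicalEpsilon FunctionalExtensionality
  PropExtensionality Arith Lia.

(** Call [f : V_lam -> V_lam] good ([cde] below) if it is Delta_0-elementary and
    cofinal.  Good maps preserve Pi_1 statements, hence f(V_a) = V_(f a), and they
    are closed under application because the Delta_0-elementarity of the set
    [k|V_a], for one formula at a time, is itself a Delta_0 property.  If some
    elementary [j] is not the identity, the Laver-Steel theorem for j, j, j, ...
    makes the critical sequence k_n = j^n(crit j) cofinal in lam, so
    V_k0 < V_k1 < ... is an elementary chain with union V_lam; a good map carries it
    to another such chain, and is therefore fully elementary.  Thus [E_lam] is closed
    under application.

    For [a < gam] the set {(u,v) in V_a x V_a | v in k(u)} lies in V_gam and its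
    image under [j] determines (j*k)(x) on V_a, whence the congruence.  If j * j and
    j agree up to gam then crit j >= gam, because crit (j*j) = j (crit j); hence
    the description of Li.  The Fibonacci terms t_2, t_3, ... are the left powers
    of the sequence t_2, t_1, t_2, t_3, ..., so the Laver-Steel theorem gives one with
    critical point above gam. *)

(** * Ordinals, stages and functions *)

Lemma mem_irrefl x : ~ x ∈ x.
Proof.
induction x as [x IH] using (well_founded_induction mem_wf).
intro H; exact (IH x H H).
Qed.

Lemma mem_asym x y : x ∈ y -> ~ y ∈ x.
Proof.
revert y; induction x as [x IH] using (well_founded_induction mem_wf).
intros y Hxy Hyx; exact (IH y Hyx x Hyx Hxy).
Qed.

Lemma mem_empty x : ~ x ∈ empty.
Proof. intro H; apply mem_node in H; destruct H as [[] _]. Qed.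

Definition succ (x : V) : V := setof (fun z => z ∈ x \/ z = x).

Lemma succP x z : z ∈ succ x <-> z ∈ x \/ z = x.
Proof.
apply (setofP (fun z => z ∈ x \/ z = x)).
destruct (is_set_union (upair x (upair x x)) (fun y z => z ∈ y)) as [s Hs].
{ intros y _; exists y; reflexivity. }
exists s; intro w; rewrite Hs; split.
- intros [y [Hy Hw]]; apply upairP in Hy; destruct Hy as [->| ->]; [tauto|].
  apply upairP in Hw; tauto.
- intros [H| ->].
  + exists x; rewrite upairP; tauto.
  + exists (upair x x); rewrite !upairP; tauto.
Qed.

Lemma ordinal_mem a b : ordinal a -> b ∈ a -> ordinal b.
Proof.
intros [Ta Ha] Hb; split; [exact (Ha b Hb)|].
intros c Hc; exact (Ha c (Ta b Hb c Hc)).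
Qed.

(** Double induction on membership: if neither ordinal belongs to the other, the induction
    hypotheses show that they have the same elements. *)
Lemma ordinal_trichotomy a b : ordinal a -> ordinal b -> a ∈ b \/ a = b \/ b ∈ a.
Proof.
revert b; induction a as [a IHa] using (well_founded_induction mem_wf).
intro b; induction b as [b IHb] using (well_founded_induction mem_wf).
intros Ha Hb; apply NNPP; intro N; apply N; right; left; apply V_ext; intro z; split.
- intro Hz; destruct (IHa z Hz b (ordinal_mem _ _ Ha Hz) Hb) as [H|[H|H]];
    [exact H|subst; tauto|].
  exfalso; apply N; right; right; exact (proj1 Ha z Hz b H).
- intro Hz; destruct (IHb z Hz Ha (ordinal_mem _ _ Hb Hz)) as [H|[H|H]];
    [|subst; tauto|exact H].
  exfalso; apply N; left; exact (proj1 Hb z Hz a H).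
Qed.

Lemma ordinal_subset a b : ordinal a -> ordinal b -> subset a b -> a ∈ b \/ a = b.
Proof.
intros Ha Hb S; destruct (ordinal_trichotomy a b Ha Hb) as [H|[H|H]]; auto.
destruct (mem_irrefl b (S b H)).
Qed.

Lemma ordinal_not_mem a b : ordinal a -> ordinal b -> ~ a ∈ b -> subset b a.
Proof.
intros Ha Hb N; destruct (ordinal_trichotomy a b Ha Hb) as [H|[->|H]].
- contradiction.
- intros z Hz; exact Hz.
- exact (proj1 Ha b H).
Qed.

Lemma ordinal_of_ordinals a :
  transitive a -> (forall b, b ∈ a -> ordinal b) -> ordinal a.
Proof. intros T H; split; [exact T|intros b Hb; exact (proj1 (H b Hb))]. Qed.

Lemma ordinal_succ a : ordinal a -> ordinal (succ a).
Proof.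
intro Ha; apply ordinal_of_ordinals.
- intros y Hy z Hz; apply succP; apply succP in Hy; left.
  destruct Hy as [Hy| ->]; [exact (proj1 Ha y Hy z Hz)|exact Hz].
- intros b Hb; apply succP in Hb.
  destruct Hb as [Hb| ->]; [exact (ordinal_mem a b Ha Hb)|exact Ha].
Qed.

Lemma ordinal_empty : ordinal empty.
Proof. split; intros y Hy; destruct (mem_empty y Hy). Qed.

Lemma limit_empty a : limit_ordinal a -> empty ∈ a.
Proof.
intros (Ha & [b Hb] & _).
destruct (ordinal_trichotomy empty a ordinal_empty Ha) as [H|[H|H]]; auto.
- rewrite <- H in Hb; destruct (mem_empty b Hb).
- destruct (mem_empty a H).
Qed.

Lemma limit_succ a b : limit_ordinal a -> b ∈ a -> succ b ∈ a.
Proof.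
intros (Ha & _ & L) Hb; destruct (L b Hb) as [c [Hc Hbc]].
destruct (ordinal_trichotomy (succ b) a) as [H|[H|H]]; auto.
- apply ordinal_succ, (ordinal_mem a b Ha Hb).
- rewrite <- H in Hc; apply succP in Hc; destruct Hc as [Hc| ->].
  + destruct (mem_asym b c Hbc Hc).
  + destruct (mem_irrefl b Hbc).
- apply succP in H; destruct H as [H| ->].
  + destruct (mem_asym a b H Hb).
  + destruct (mem_irrefl b Hb).
Qed.

Lemma succ_inj a b : succ a = succ b -> a = b.
Proof.
intro E.
assert (Ha : a ∈ succ b) by (rewrite <- E; apply succP; auto).
assert (Hb : b ∈ succ a) by (rewrite E; apply succP; auto).
apply succP in Ha, Hb; destruct Ha as [Ha|Ha]; auto; destruct Hb as [Hb|Hb]; auto.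
destruct (mem_asym a b Ha Hb).
Qed.

(** * Infinite cardinals are limit ordinals *)

Fixpoint num (n : nat) : V :=
  match n with O => empty | S m => succ (num m) end.

Lemma num_limit a n : limit_ordinal a -> num n ∈ a.
Proof. intro H; induction n; simpl; [apply limit_empty|apply limit_succ]; auto. Qed.

(** Hilbert's hotel: [b] maps to [0], each natural number to its successor, and
    every other ordinal below [b] to itself. *)
Definition hotel (b y : V) : V :=
  if excluded_middle_informative (y = b) then empty
  else if excluded_middle_informative (exists n, y = num n) then succ y else y.

Lemma hotel_bijection b g :
  ordinal b -> limit_ordinal g -> subset g b ->
  exists f, is_bijection f b (succ b).
Proof.
intros Hb Hg S.
assert (Nb : forall n, num n <> b).
{ intros n E; apply (mem_irrefl b); rewrite <- E at 1; apply S, num_limit, Hg. }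
assert (Hh : forall y, y ∈ succ b -> hotel b y ∈ b).
{ intros y Hy; unfold hotel; destruct (excluded_middle_informative _) as [E|E].
  - apply S, limit_empty, Hg.
  - destruct (excluded_middle_informative _) as [[n ->]|E'].
    + apply S, (num_limit g (Datatypes.S n) Hg).
    + apply succP in Hy; tauto. }
assert (Inj : forall y y', hotel b y = hotel b y' -> y = y').
{ assert (SE : forall y, succ y <> empty).
  { intros y E; apply (mem_empty y); rewrite <- E; apply succP; auto. }
  intros y y'; unfold hotel.
  destruct (excluded_middle_informative (y = b)) as [->|Y];
    destruct (excluded_middle_informative (y' = b)) as [->|Y']; auto;
    repeat destruct (excluded_middle_informative (exists n, _)) as [[? ->]|?];
    intro E; auto.
  - destruct (SE _ (eq_sym E)).
  - subst y'; exfalso.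
    match goal with H : ~ _ |- _ => apply H; exists 0; reflexivity end.
  - destruct (SE _ E).
  - subst y; exfalso.
    match goal with H : ~ _ |- _ => apply H; exists 0; reflexivity end.
  - apply succ_inj, E.
  - subst y'; exfalso.
    match goal with H : ~ _ |- _ => apply H; eexists (Datatypes.S _); reflexivity end.
  - subst y; exfalso.
    match goal with H : ~ _ |- _ => apply H; eexists (Datatypes.S _); reflexivity end. }
assert (Sur : forall x, x ∈ b -> exists y, y ∈ succ b /\ hotel b y = x).
{ intros x Hx; destruct (classic (exists n, x = num n)) as [[n ->]|N].
  - destruct n as [|n].
    + exists b; split; [apply succP; auto|unfold hotel].
      destruct (excluded_middle_informative _); [reflexivity|congruence].
    + exists (num n); split; [apply succP; left; apply S, num_limit, Hg|unfold hotel].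
      destruct (excluded_middle_informative _) as [E|_]; [destruct (Nb n E)|].
      destruct (excluded_middle_informative _) as [_|E]; [reflexivity|].
      destruct E; exists n; reflexivity.
  - exists x; split; [apply succP; auto|unfold hotel].
    destruct (excluded_middle_informative _) as [->|_]; [destruct (mem_irrefl b Hx)|].
    destruct (excluded_middle_informative _); tauto. }
(* The graph is that of the inverse of [hotel b], because [cardinal] excludes bijections from a
   smaller ordinal onto the larger one. *)
destruct (is_set_union (succ b) (fun y z => z = opair (hotel b y) y)) as [f Hf].
{ intros y _; exists (upair (opair (hotel b y) y) (opair (hotel b y) y)).
  intro z; rewrite upairP; tauto. }
exists f; split; [split|].
- intros z Hz; apply Hf in Hz; destruct Hz as [y [Hy ->]].
  exists (hotel b y), y; auto.
- intros x Hx; destruct (Sur x Hx) as [y [Hy <-]]; exists y; split.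
  + apply Hf; exists y; auto.
  + intros y' H; apply Hf in H; destruct H as [y0 [_ E]].
    apply opair_inj in E; destruct E as [E ->]; exact (Inj _ _ E).
- intros y Hy; exists (hotel b y); split.
  + apply Hf; exists y; auto.
  + intros x H; apply Hf in H; destruct H as [y0 [_ E]].
    apply opair_inj in E; destruct E as [E ->]; symmetry; exact E.
Qed.

(** If [lam] were the successor of [b], then [gam] would be contained in [b], and Hilbert's hotel
    would give a bijection from [b] onto [lam]. *)
Lemma cardinal_limit lam gam :
  cardinal lam -> limit_ordinal gam -> gam ∈ lam -> limit_ordinal lam.
Proof.
intros [Ol C] Hg Hin; split; [exact Ol|]; split; [exists gam; exact Hin|].
intros b Hb; exists (succ b); split; [|apply succP; auto].
pose proof (ordinal_mem _ _ Ol Hb) as Ob.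
destruct (ordinal_trichotomy (succ b) lam) as [H|[H|H]]; auto.
- apply ordinal_succ, Ob.
- exfalso; apply (C b Hb); rewrite <- H; apply (hotel_bijection b gam Ob Hg).
  rewrite <- H in Hin; apply succP in Hin; destruct Hin as [Hin| ->].
  + apply (proj1 Ob), Hin.
  + intros z Hz; exact Hz.
- apply succP in H; destruct H as [H| ->].
  + destruct (mem_asym _ _ H Hb).
  + destruct (mem_irrefl _ Hb).
Qed.

(** * Stages of the cumulative hierarchy *)

Lemma stage_intro a b x : b ∈ a -> subset x (stage b) -> x ∈ stage a.
Proof. intros; apply stageP; eauto. Qed.

Lemma stage_mono a b : subset a b -> subset (stage a) (stage b).
Proof.
intros S x Hx; apply stageP in Hx; destruct Hx as [c [Hc Hx]].
exact (stage_intro b c x (S c Hc) Hx).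
Qed.

Lemma stage_subset a x y : x ∈ stage a -> subset y x -> y ∈ stage a.
Proof.
intros Hx S; apply stageP in Hx; destruct Hx as [c [Hc Hx]].
apply (stage_intro a c y Hc); intros z Hz; apply Hx, S, Hz.
Qed.

Lemma stage_transitive a : ordinal a -> transitive (stage a).
Proof.
intros Ha x Hx; apply stageP in Hx; destruct Hx as [c [Hc Hx]].
intros y Hy; apply (stage_mono c a); [exact (proj1 Ha c Hc)|apply Hx, Hy].
Qed.

Lemma stage_mem a b : b ∈ a -> stage b ∈ stage a.
Proof. intro H; apply (stage_intro a b _ H); intros z Hz; exact Hz. Qed.

Lemma ordinal_subset_stage a : ordinal a -> subset a (stage a).
Proof.
induction a as [a IH] using (well_founded_induction mem_wf); intros Ha b Hb.
exact (stage_intro a b b Hb (IH b Hb (ordinal_mem a b Ha Hb))).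
Qed.

Lemma ordinal_mem_stage a d : ordinal a -> ordinal d -> (d ∈ stage a <-> d ∈ a).
Proof.
intros Ha Hd; split; [|apply ordinal_subset_stage, Ha].
revert d Hd; induction a as [a IH] using (well_founded_induction mem_wf).
intros d Hd H; apply stageP in H; destruct H as [b [Hb H]].
pose proof (ordinal_mem a b Ha Hb) as Ob.
destruct (ordinal_subset d b Hd Ob) as [K| ->]; auto.
- intros e He; apply (IH b Hb Ob); [exact (ordinal_mem d e Hd He)|apply H, He].
- exact (proj1 Ha b Hb d K).
Qed.

Lemma stage_limit a x : limit_ordinal a -> x ∈ stage a -> exists b, b ∈ a /\ x ∈ stage b.
Proof.
intros Ha Hx; apply stageP in Hx; destruct Hx as [b [Hb Hx]].
exists (succ b); split; [apply limit_succ; auto|].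
apply (stage_intro _ b); [apply succP; auto|exact Hx].
Qed.

Lemma ordinal_max a b c :
  ordinal a -> b ∈ a -> c ∈ a -> exists d, d ∈ a /\ subset b d /\ subset c d.
Proof.
intros Ha Hb Hc.
pose proof (ordinal_mem _ _ Ha Hb) as Ob; pose proof (ordinal_mem _ _ Ha Hc) as Oc.
destruct (ordinal_trichotomy b c Ob Oc) as [H|[->|H]].
- exists c; split; [exact Hc|split; [exact (proj1 Oc b H)|intros z Hz; exact Hz]].
- exists c; split; [exact Hc|split; intros z Hz; exact Hz].
- exists b; split; [exact Hb|split; [intros z Hz; exact Hz|exact (proj1 Ob c H)]].
Qed.

Lemma stage_limit2 a x y : limit_ordinal a -> x ∈ stage a -> y ∈ stage a ->
  exists b, b ∈ a /\ x ∈ stage b /\ y ∈ stage b.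
Proof.
intros Ha Hx Hy.
destruct (stage_limit a x Ha Hx) as [b [Hb Hxb]].
destruct (stage_limit a y Ha Hy) as [c [Hc Hyc]].
destruct (ordinal_max a b c (proj1 Ha) Hb Hc) as (d & Hd & Sb & Sc).
exists d; split; [exact Hd|split; [exact (stage_mono _ _ Sb _ Hxb)|]].
exact (stage_mono _ _ Sc _ Hyc).
Qed.

(** Only finitely many entries can be bounded, since [a] may have countable cofinality; this
    suffices because a formula sees only finitely many variables. *)
Lemma stage_limit_fin a (e : nat -> V) N : limit_ordinal a ->
  (forall n, e n ∈ stage a) -> exists b, b ∈ a /\ forall n, n < N -> e n ∈ stage b.
Proof.
intros Ha He; induction N as [|N [b [Hb IH]]].
- exists empty; split; [apply limit_empty, Ha|lia].
- destruct (stage_limit a (e N) Ha (He N)) as [c [Hc Hec]].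
  destruct (ordinal_max a b c (proj1 Ha) Hb Hc) as (d & Hd & Sb & Sc).
  exists d; split; [exact Hd|]; intros n Hn.
  destruct (Nat.eq_dec n N) as [->|Hne]; [exact (stage_mono _ _ Sc _ Hec)|].
  apply (stage_mono _ _ Sb), IH; lia.
Qed.

Lemma upair_subset x y s : x ∈ s -> y ∈ s -> subset (upair x y) s.
Proof. intros Hx Hy z Hz; apply upairP in Hz; destruct Hz as [->| ->]; assumption. Qed.

Lemma opair_stage_succ x y b :
  x ∈ stage b -> y ∈ stage b -> opair x y ∈ stage (succ (succ b)).
Proof.
intros Hx Hy; apply (stage_intro _ (succ b)); [apply succP; auto|].
apply upair_subset;
  (apply (stage_intro _ b); [apply succP; auto|apply upair_subset; assumption]).
Qed.

Lemma opair_stage a x y :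
  limit_ordinal a -> x ∈ stage a -> y ∈ stage a -> opair x y ∈ stage a.
Proof.
intros Ha Hx Hy; destruct (stage_limit2 a x y Ha Hx Hy) as (b & Hb & Hxb & Hyb).
apply (stage_mono (succ (succ b))); [|apply opair_stage_succ; assumption].
apply (proj1 (proj1 Ha)); apply limit_succ; [exact Ha|apply limit_succ; assumption].
Qed.

Lemma interP x y z : z ∈ inter x y <-> z ∈ x /\ z ∈ y.
Proof. apply (setofP (fun z => z ∈ x /\ z ∈ y)), (is_set_sub x); tauto. Qed.

Lemma restrictP f A z :
  z ∈ restrict f A <-> z ∈ f /\ exists x y, x ∈ A /\ z = opair x y.
Proof.
apply (setofP (fun z => z ∈ f /\ exists x y, x ∈ A /\ z = opair x y)), (is_set_sub f).
tauto.
Qed.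

Lemma opair_restrict f A x y : opair x y ∈ restrict f A <-> opair x y ∈ f /\ x ∈ A.
Proof.
rewrite restrictP; split.
- intros [H (x' & y' & Hx & E)]; apply opair_inj in E; destruct E as [-> ->]; auto.
- intros [H Hx]; split; [exact H|exists x, y; auto].
Qed.

Lemma identityP A z : z ∈ identity A <-> exists x, x ∈ A /\ z = opair x x.
Proof.
apply (setofP (fun z => exists x, x ∈ A /\ z = opair x x)).
apply (is_set_union A (fun x z => z = opair x x)).
intros x _; exists (upair (opair x x) (opair x x)); intro w; rewrite upairP; tauto.
Qed.

Lemma opair_identity A x y : opair x y ∈ identity A <-> x ∈ A /\ y = x.
Proof.
rewrite identityP; split.
- intros [u [Hu E]]; apply opair_inj in E; destruct E as [-> ->]; auto.
- intros [Hx ->]; exists x; auto.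
Qed.

(** * Functions as sets of pairs *)

Lemma is_function_pair f A B x y :
  is_function f A B -> opair x y ∈ f -> x ∈ A /\ y ∈ B.
Proof.
intros [F _] H; destruct (F _ H) as (x' & y' & Hx & Hy & E).
apply opair_inj in E; destruct E as [-> ->]; auto.
Qed.

Lemma ap_pair f A B x : is_function f A B -> x ∈ A -> opair x (ap f x) ∈ f.
Proof.
intros [_ F] Hx; destruct (F x Hx) as [y [Hy _]].
exact (epsilon_spec (inhabits empty) (fun y => opair x y ∈ f) (ex_intro _ y Hy)).
Qed.

Lemma ap_eq f A B x y : is_function f A B -> opair x y ∈ f -> ap f x = y.
Proof.
intros F H; destruct (is_function_pair f A B x y F H) as [Hx _].
destruct (proj2 F x Hx) as [y' [_ U]].
rewrite <- (U y H); symmetry; apply U, (ap_pair f A B x F Hx).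
Qed.

Lemma ap_mem f A B x : is_function f A B -> x ∈ A -> ap f x ∈ B.
Proof. intros F Hx; apply (is_function_pair f A B x _ F (ap_pair f A B x F Hx)). Qed.

Lemma opair_ap f A B x y :
  is_function f A B -> x ∈ A -> (opair x y ∈ f <-> y = ap f x).
Proof.
intros F Hx; split.
- intro H; symmetry; exact (ap_eq f A B x y F H).
- intros ->; exact (ap_pair f A B x F Hx).
Qed.

Lemma function_ext f g A B C : is_function f A B -> is_function g A C ->
  (forall x, x ∈ A -> ap f x = ap g x) -> f = g.
Proof.
intros F G H; apply V_ext; intro z; split; intro Hz.
- destruct (proj1 F z Hz) as (x & y & Hx & _ & ->).
  apply (opair_ap g A C x y G Hx); rewrite <- H by exact Hx.
  apply (opair_ap f A B x y F Hx), Hz.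
- destruct (proj1 G z Hz) as (x & y & Hx & _ & ->).
  apply (opair_ap f A B x y F Hx); rewrite H by exact Hx.
  apply (opair_ap g A C x y G Hx), Hz.
Qed.

Lemma identity_function A : is_function (identity A) A A.
Proof.
split.
- intros z Hz; apply identityP in Hz; destruct Hz as [x [Hx ->]]; exists x, x; auto.
- intros x Hx; exists x; split; [apply opair_identity; auto|].
  intros y Hy; apply opair_identity in Hy; symmetry; tauto.
Qed.

Lemma ap_identity A x : x ∈ A -> ap (identity A) x = x.
Proof.
intro Hx; apply (ap_eq _ A A); [apply identity_function|apply opair_identity; auto].
Qed.

(** * Delta_0 predicates *)

(** The predicates definable by Delta_0 formulas; being absolute, they need no
    structure in which to be evaluated. *)
Inductive D0 : ((nat -> V) -> Prop) -> Prop :=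
| D0_mem i j : D0 (fun e => e i ∈ e j)
| D0_eq i j : D0 (fun e => e i = e j)
| D0_false : D0 (fun _ => False)
| D0_imp P Q : D0 P -> D0 Q -> D0 (fun e => P e -> Q e)
| D0_ball i P : D0 P -> D0 (fun e => forall x, x ∈ e i -> P (scons x e)).

Lemma D0_iff (P Q : (nat -> V) -> Prop) : D0 P -> (forall e, P e <-> Q e) -> D0 Q.
Proof.
intros HP H; replace Q with P; [exact HP|].
apply functional_extensionality; intro e; apply propositional_extensionality, H.
Qed.

(** [D0_ball] with the bound variable split off from the environment, a form that unifies with
    predicates written in the usual way. *)
Lemma D0_all i (P : V -> (nat -> V) -> Prop) :
  D0 (fun e => P (e 0) (fun n => e (S n))) ->
  D0 (fun e => forall x, x ∈ e i -> P x e).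
Proof. exact (D0_ball i _). Qed.

Lemma D0_not P : D0 P -> D0 (fun e => ~ P e).
Proof. intro H; exact (D0_imp _ _ H D0_false). Qed.

Lemma D0_and P Q : D0 P -> D0 Q -> D0 (fun e => P e /\ Q e).
Proof.
intros HP HQ.
apply (D0_iff _ _ (D0_not _ (D0_imp _ _ HP (D0_not _ HQ)))); intro e; tauto.
Qed.

Lemma D0_or P Q : D0 P -> D0 Q -> D0 (fun e => P e \/ Q e).
Proof.
intros HP HQ; apply (D0_iff _ _ (D0_imp _ _ (D0_not _ HP) HQ)); intro e; tauto.
Qed.

Lemma D0_equiv P Q : D0 P -> D0 Q -> D0 (fun e => P e <-> Q e).
Proof. intros HP HQ; apply D0_and; apply D0_imp; assumption. Qed.

Lemma D0_ex i (P : V -> (nat -> V) -> Prop) :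
  D0 (fun e => P (e 0) (fun n => e (S n))) ->
  D0 (fun e => exists x, x ∈ e i /\ P x e).
Proof.
intro H.
apply (D0_iff _ _ (D0_not _ (D0_all i (fun x e => ~ P x e) (D0_not _ H)))); intro e.
split.
- intro N; apply NNPP; intro K; apply N; intros x Hx HP; apply K; exists x; auto.
- intros [x [Hx HP]] N; exact (N x Hx HP).
Qed.

Ltac d0 := repeat (cbv beta; first
  [ apply D0_mem | apply D0_eq | apply D0_all | apply D0_ex | apply D0_and
  | apply D0_or | apply D0_equiv | apply D0_not | apply D0_imp | solve [eauto with d0] ]).

Lemma D0_subset i j : D0 (fun e => subset (e i) (e j)).
Proof. unfold subset; d0. Qed.
#[local] Hint Resolve D0_subset : d0.

Lemma D0_upair i j k : D0 (fun e => e k = upair (e i) (e j)).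
Proof.
apply (D0_iff (fun e => e i ∈ e k /\ e j ∈ e k /\
                        forall z, z ∈ e k -> z = e i \/ z = e j)); [d0|].
intro e; split.
- intros (Hi & Hj & H); apply V_ext; intro z; rewrite upairP; split; [apply H|].
  intros [->| ->]; assumption.
- intros ->; setoid_rewrite upairP; tauto.
Qed.
#[local] Hint Resolve D0_upair : d0.

(** The two unordered pairs that make up an ordered pair are its elements, so the quantifiers over
    them are bounded by [e k]. *)
Lemma D0_opair i j k : D0 (fun e => e k = opair (e i) (e j)).
Proof.
apply (D0_iff (fun e => (exists u, u ∈ e k /\ u = upair (e i) (e i)) /\
  (exists u, u ∈ e k /\ u = upair (e i) (e j)) /\
  forall z, z ∈ e k -> z = upair (e i) (e i) \/ z = upair (e i) (e j))); [d0|].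
intro e; split.
- intros ((u & Hu & Eu) & (v & Hv & Ev) & H); subst; apply V_ext; intro z.
  unfold opair; rewrite upairP; split; [apply H|].
  intros [->| ->]; assumption.
- intros ->; unfold opair; split; [|split].
  + exists (upair (e i) (e i)); rewrite upairP; auto.
  + exists (upair (e i) (e j)); rewrite upairP; auto.
  + intro z; rewrite upairP; auto.
Qed.
#[local] Hint Resolve D0_opair : d0.

Lemma D0_opair_mem i j k : D0 (fun e => opair (e i) (e j) ∈ e k).
Proof.
apply (D0_iff (fun e => exists z, z ∈ e k /\ z = opair (e i) (e j))); [d0|].
intro e; split; [intros [z [Hz <-]]; exact Hz|eauto].
Qed.
#[local] Hint Resolve D0_opair_mem : d0.

Lemma D0_transitive i : D0 (fun e => transitive (e i)).
Proof. unfold transitive; d0. Qed.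
#[local] Hint Resolve D0_transitive : d0.

Lemma D0_ordinal i : D0 (fun e => ordinal (e i)).
Proof. unfold ordinal; d0. Qed.
#[local] Hint Resolve D0_ordinal : d0.

(** All values lie in the codomain by the first clause, so the unique existence in the second may be
    bounded by it. *)
Lemma D0_function i j k : D0 (fun e => is_function (e i) (e j) (e k)).
Proof.
apply (D0_iff (fun e =>
  (forall z, z ∈ e i -> exists x, x ∈ e j /\ exists y, y ∈ e k /\ z = opair x y) /\
  (forall x, x ∈ e j -> exists y, y ∈ e k /\ (opair x y ∈ e i /\
     forall y', y' ∈ e k -> opair x y' ∈ e i -> y = y')))); [d0|].
intro e; split; intros [F G]; split.
- intros z Hz; destruct (F z Hz) as (x & Hx & y & Hy & E); eauto.
- intros x Hx; destruct (G x Hx) as (y & Hy & H & U); exists y; split; [exact H|].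
  intros y' H'; apply U; [|exact H'].
  destruct (F _ H') as (x1 & _ & y1 & Hy1 & E); apply opair_inj in E.
  destruct E as [_ ->]; exact Hy1.
- intros z Hz; destruct (F z Hz) as (x & y & Hx & Hy & E); eauto.
- intros x Hx; destruct (G x Hx) as (y & H & U); exists y.
  destruct (is_function_pair _ _ _ _ _ (conj F G) H) as [_ Hy]; eauto.
Qed.
#[local] Hint Resolve D0_function : d0.

(** * Renaming, finite support and blocks of bounded quantifiers *)

Lemma scons_rename x (e : nat -> V) r :
  scons x (fun n => e (r n)) =
  (fun n => scons x e (match n with O => O | S m => S (r m) end)).
Proof. apply functional_extensionality; intros [|n]; reflexivity. Qed.

Lemma D0_rename P r : D0 P -> D0 (fun e => P (fun n => e (r n))).
Proof.
intro H; revert r; induction H; intro r; try (constructor; auto; fail).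
apply (D0_iff (fun e => forall x, x ∈ e (r i) ->
  P (fun n => scons x e (match n with O => O | S m => S (r m) end)))).
- exact (D0_ball (r i) _ (IHD0 (fun n => match n with O => O | S m => S (r m) end))).
- intro e; split; intros K x Hx; [rewrite scons_rename|rewrite <- scons_rename]; auto.
Qed.

Lemma D0_support P : D0 P -> exists N, forall e e',
  (forall n, n < N -> e n = e' n) -> (P e <-> P e').
Proof.
induction 1 as [i j|i j| |P Q _ [N1 H1] _ [N2 H2]|i P _ [N HN]].
- exists (S (i + j)); intros e e' H; rewrite (H i), (H j) by lia; tauto.
- exists (S (i + j)); intros e e' H; rewrite (H i), (H j) by lia; tauto.
- exists 0; tauto.
- exists (N1 + N2); intros e e' H.
  rewrite (H1 e e'), (H2 e e') by (intros n Hn; apply H; lia); tauto.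
- exists (S (i + N)); intros e e' H.
  assert (K : forall x, P (scons x e) <-> P (scons x e')).
  { intro x; apply HN; intros [|n] Hn; simpl; [reflexivity|apply H; lia]. }
  rewrite (H i) by lia; split; intros L x Hx; apply K, L, Hx.
Qed.

(** For a fixed formula every quantifier ranges over the structure, which is itself a variable here,
    and hence is bounded. The renaming [r] makes the induction pass under quantifiers. *)
Lemma D0_sat p m r : D0 (fun e => sat (e m) p (fun n => e (r n))).
Proof.
revert m r; induction p as [i j|i j| |p IHp q IHq|p IH]; intros m r; simpl.
- apply (D0_mem (r i) (r j)).
- apply (D0_eq (r i) (r j)).
- apply D0_false.
- apply D0_imp; auto.
- apply (D0_iff (fun e => forall x, x ∈ e m ->
    sat (e m) p (fun n => scons x e (match n with O => O | S k => S (r k) end)))).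
  + exact (D0_ball m _ (IH (S m) (fun n => match n with O => O | S k => S (r k) end))).
  + intro e; split; intros K x Hx; [rewrite scons_rename|rewrite <- scons_rename]; auto.
Qed.

(** [prefix k e E] lists [e 0, ..., e (k-1)] and then continues with [E]. *)
Fixpoint prefix (k : nat) (e E : nat -> V) : nat -> V :=
  match k with O => E | S m => prefix m e (scons (e m) E) end.

Lemma prefix_high k e E n : prefix k e E (k + n) = E n.
Proof.
revert E n; induction k as [|k IH]; intros E n; simpl; [reflexivity|].
rewrite <- Nat.add_succ_r, IH; reflexivity.
Qed.

Lemma prefix_low k e E n : n < k -> prefix k e E n = e n.
Proof.
revert E n; induction k as [|k IH]; intros E n Hn; simpl; [lia|].
destruct (Nat.eq_dec n k) as [->|]; [|apply IH; lia].
pose proof (prefix_high k e (scons (e k) E) 0) as H.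
rewrite Nat.add_0_r in H; exact H.
Qed.

Lemma prefix_ext k e e' E :
  (forall n, n < k -> e n = e' n) -> prefix k e E = prefix k e' E.
Proof.
revert E; induction k as [|k IH]; intros E H; simpl; [reflexivity|].
rewrite (H k) by lia; apply IH; intros n Hn; apply H; lia.
Qed.

(** A block of [k] quantifiers bounded by the set at index [m]; each new value shifts the
    environment, so the same set is next found at [S m]. *)
Fixpoint all_prefix (k m : nat) (P : (nat -> V) -> Prop) (E : nat -> V) : Prop :=
  match k with
  | O => P E
  | S l => forall x, x ∈ E m -> all_prefix l (S m) P (scons x E)
  end.

Lemma D0_all_prefix k m P : D0 P -> D0 (all_prefix k m P).
Proof.
intro H; revert m; induction k as [|k IH]; intro m; simpl; [exact H|].
apply (D0_ball m (all_prefix k (S m) P)), IH.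
Qed.

(** The hypothesis speaks of infinite sequences in [E m]; an element of [E m] fills the coordinates
    beyond the prefix. *)
Lemma all_prefix_intro k m P E :
  (forall e, (forall n, e n ∈ E m) -> P (prefix k e E)) ->
  (exists x, x ∈ E m) -> all_prefix k m P E.
Proof.
revert m E; induction k as [|k IH]; intros m E H [x0 Hx0]; simpl.
- apply (H (fun _ => x0)); auto.
- intros x Hx; apply IH; [|exists x; exact Hx]; simpl; intros e He.
  specialize (H (fun n => if Nat.eq_dec n k then x else e n)); simpl in H.
  destruct (Nat.eq_dec k k) as [_|]; [|lia].
  rewrite <- (prefix_ext k (fun n => if Nat.eq_dec n k then x else e n) e).
  + apply H; intro n; destruct (Nat.eq_dec n k); auto.
  + intros n Hn; destruct (Nat.eq_dec n k); [lia|reflexivity].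
Qed.

Lemma all_prefix_elim k m P E :
  all_prefix k m P E -> forall e, (forall n, e n ∈ E m) -> P (prefix k e E).
Proof.
revert m E; induction k as [|k IH]; intros m E H e He; simpl in *; [exact H|].
apply (IH (S m)); [apply H, He|exact He].
Qed.

(** * Cofinal Delta_0-elementary maps *)

Section Embeddings.

Context (lam : V) (Hl : limit_ordinal lam).

Notation M := (stage lam).

(** The last clause is cofinality: the values of [f] cover V_lam, so each element of V_lam lies
    under a bound of the form [ap f y]. *)
Definition cde (f : V) : Prop :=
  is_function f M M /\
  (forall P, D0 P -> forall e, (forall n, e n ∈ M) ->
     (P e <-> P (fun n => ap f (e n)))) /\
  (forall x, x ∈ M -> exists y, y ∈ M /\ x ∈ ap f y).

Lemma cde_mem f x : cde f -> x ∈ M -> ap f x ∈ M.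
Proof. intros [F _]; apply ap_mem, F. Qed.

Lemma cde4 f (R : V -> V -> V -> V -> Prop) :
  cde f -> D0 (fun e => R (e 0) (e 1) (e 2) (e 3)) ->
  forall a b c d, a ∈ M -> b ∈ M -> c ∈ M -> d ∈ M ->
  (R a b c d <-> R (ap f a) (ap f b) (ap f c) (ap f d)).
Proof.
intros (_ & F & _) D a b c d Ha Hb Hc Hd.
apply (F _ D (scons a (scons b (scons c (fun _ => d))))).
intros [|[|[|n]]]; assumption.
Qed.

Lemma cde3 f (R : V -> V -> V -> Prop) :
  cde f -> D0 (fun e => R (e 0) (e 1) (e 2)) ->
  forall a b c, a ∈ M -> b ∈ M -> c ∈ M ->
  (R a b c <-> R (ap f a) (ap f b) (ap f c)).
Proof.
intros F D a b c Ha Hb Hc; apply (cde4 f (fun a b c _ => R a b c) F D a b c c); auto.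
Qed.

Lemma cde2 f (R : V -> V -> Prop) :
  cde f -> D0 (fun e => R (e 0) (e 1)) ->
  forall a b, a ∈ M -> b ∈ M -> (R a b <-> R (ap f a) (ap f b)).
Proof. intros F D a b Ha Hb; apply (cde3 f (fun a b _ => R a b) F D a b b); auto. Qed.

(** Preservation of Pi_1 statements: by cofinality [x] lies in some [ap f y], and the statement with
    its quantifier bounded by [y] is Delta_0. *)
Lemma cde_forall f (R : V -> V -> V -> Prop) :
  cde f -> D0 (fun e => R (e 0) (e 1) (e 2)) ->
  forall a b, a ∈ M -> b ∈ M -> (forall x, x ∈ M -> R x a b) ->
  forall x, x ∈ M -> R x (ap f a) (ap f b).
Proof.
intros F D a b Ha Hb H x Hx.
destruct (proj2 (proj2 F) x Hx) as [y [Hy Hxy]].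
assert (D' : D0 (fun e => forall x, x ∈ e 2 -> R x (e 0) (e 1))).
{ apply D0_all, D. }
apply (cde3 f (fun a b y => forall x, x ∈ y -> R x a b) F D' a b y Ha Hb Hy);
  [|exact Hxy].
intros z Hz; apply H, (stage_transitive lam (proj1 Hl) y Hy z Hz).
Qed.

(** [P] depends on finitely many coordinates of [e], so the quantifier over all
    sequences in [A] is a finite block of bounded quantifiers. *)
Lemma cde_env f P A a b :
  cde f -> D0 P -> A ∈ M -> a ∈ M -> b ∈ M -> (exists x, x ∈ A) ->
  (forall e, (forall n, e n ∈ A) -> P (scons a (scons b e))) ->
  forall e, (forall n, e n ∈ ap f A) -> P (scons (ap f a) (scons (ap f b) e)).
Proof.
intros F D HA Ha Hb NA H e He; destruct (D0_support P D) as [N S].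
(* [prefix] puts the [N] quantified values first and [a], [b] at positions [N] and [N + 1]; [r]
   restores the order in which [P] reads them. *)
pose (r := fun n => match n with O => N | 1 => N + 1 | Datatypes.S (Datatypes.S m) => m end).
assert (K : forall a b A e,
  P (fun n => prefix N e (scons a (scons b (fun _ => A))) (r n)) <->
  P (scons a (scons b e))).
{ clear - S; intros a b A e; apply S; intros [|[|n]] Hn; simpl.
  - pose proof (prefix_high N e (scons a (scons b (fun _ => A))) 0) as H.
    rewrite Nat.add_0_r in H; exact H.
  - rewrite prefix_high; reflexivity.
  - apply prefix_low; lia. }
pose proof (D0_all_prefix N 2 _ (D0_rename P r D)) as D'.
pose (E := scons a (scons b (fun _ => A))).
apply (K _ _ (ap f A)).
apply (all_prefix_elim N 2 (fun e => P (fun n => e (r n)))); [|exact He].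
assert (L : all_prefix N 2 (fun e => P (fun n => e (r n))) E).
{ apply all_prefix_intro; [|exact NA]; intros e' He'; apply K, H, He'. }
apply (proj1 (proj2 F) _ D' E) in L; [|intros [|[|n]]; assumption].
assert (EE : (fun n => ap f (E n)) =
             scons (ap f a) (scons (ap f b) (fun _ => ap f A))).
{ apply functional_extensionality; intros [|[|n]]; reflexivity. }
rewrite EE in L; exact L.
Qed.

(** * Elementary embeddings are cofinal and Delta_0-elementary *)

Lemma D0_formula P : D0 P -> exists p, forall e, (forall n, e n ∈ M) -> (sat M p e <-> P e).
Proof.
induction 1 as [i j|i j| |P Q _ [p Hp] _ [q Hq]|i P _ [p Hp]].
- exists (fMem i j); reflexivity.
- exists (fEq i j); reflexivity.
- exists fFalse; reflexivity.
- exists (fImp p q); intros e He; simpl; rewrite Hp, Hq by exact He; reflexivity.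
- exists (fAll (fImp (fMem 0 (S i)) p)); intros e He; simpl.
  assert (K : forall x, x ∈ M -> (sat M p (scons x e) <-> P (scons x e))).
  { intros x Hx; apply Hp; intros [|n]; simpl; auto. }
  split; intros H x Hx.
  + assert (Hx' : x ∈ M) by exact (stage_transitive lam (proj1 Hl) _ (He i) x Hx).
    apply K; auto.
  + intro Hxe; apply K; auto.
Qed.

Lemma Emb_D0 j P : Emb lam j -> D0 P -> forall e, (forall n, e n ∈ M) ->
  (P e <-> P (fun n => ap j (e n))).
Proof.
intros [F EJ] D e He; destruct (D0_formula P D) as [p Hp].
rewrite <- (Hp e He), <- Hp; [apply EJ, He|intro n; apply (ap_mem j M M _ F), He].
Qed.

(** Pi_1 preservation directly from full elementarity; it serves to prove the cofinality that
    [cde_forall] presupposes. *)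
Lemma Emb_forall j P : Emb lam j -> D0 P -> forall e, (forall n, e n ∈ M) ->
  (forall x, x ∈ M -> P (scons x e)) ->
  (forall x, x ∈ M -> P (scons x (fun n => ap j (e n)))).
Proof.
intros [F EJ] D e He H; destruct (D0_formula P D) as [p Hp].
assert (K : sat M (fAll p) e).
{ intros x Hx; apply Hp; [intros [|n]; simpl; auto|apply H, Hx]. }
intros x Hx; apply Hp.
- intros [|n]; simpl; auto; apply (ap_mem j M M _ F), He.
- apply (proj1 (EJ (fAll p) e He) K x Hx).
Qed.

(** [j V_a] contains every subset of its elements, in particular every subset of
    [j V_b] for [b] in [a]. *)
Lemma Emb_stage_subset j a : Emb lam j -> a ∈ lam -> subset (stage a) (ap j (stage a)).
Proof.
intro J; induction a as [a IH] using (well_founded_induction mem_wf); intro Ha.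
intros x Hx; apply stageP in Hx; destruct Hx as [b [Hb Hx]].
pose proof (proj1 (proj1 Hl) a Ha b Hb) as Hbl.
pose proof (ordinal_mem _ _ (proj1 Hl) Ha) as Oa.
assert (D1 : D0 (fun e => e 0 ∈ e 1)) by apply D0_mem.
assert (Hm : ap j (stage b) ∈ ap j (stage a)).
{ apply (Emb_D0 j _ J D1 (scons (stage b) (fun _ => stage a))).
  - intros [|n]; apply stage_mem; assumption.
  - apply stage_mem, Hb. }
assert (D2 : D0 (fun e => forall z, z ∈ e 1 -> subset (e 0) z -> e 0 ∈ e 1)) by d0.
apply (Emb_forall j _ J D2 (fun _ => stage a)) with (z := ap j (stage b)).
- intro; apply stage_mem, Ha.
- simpl; intros y _ z Hz S; exact (stage_subset a z y Hz S).
- apply (stage_intro lam b x Hbl Hx).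
- exact Hm.
- simpl; intros z Hz; apply IH; auto.
Qed.

Lemma Emb_cde j : Emb lam j -> cde j.
Proof.
intro J; split; [apply J|split; [intros P D; apply (Emb_D0 j P J D)|]].
intros x Hx; destruct (stage_limit lam x Hl Hx) as [a [Ha Hxa]].
exists (stage a); split; [apply stage_mem, Ha|].
apply (Emb_stage_subset j a J Ha x Hxa).
Qed.

(** * Action on ordinals and stages *)

Lemma ord_in_M a : a ∈ lam -> a ∈ M.
Proof. apply ordinal_subset_stage, Hl. Qed.

Lemma ord_lam a : a ∈ lam -> ordinal a.
Proof. apply ordinal_mem, Hl. Qed.

Lemma cde_in f x y : cde f -> x ∈ M -> y ∈ M -> (x ∈ y <-> ap f x ∈ ap f y).
Proof. intros F; apply (cde2 f (fun x y => x ∈ y) F); d0. Qed.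

Lemma cde_eq f x y : cde f -> x ∈ M -> y ∈ M -> (x = y <-> ap f x = ap f y).
Proof. intros F; apply (cde2 f (fun x y => x = y) F); d0. Qed.

Lemma cde_subset f x y : cde f -> x ∈ M -> y ∈ M -> (subset x y <-> subset (ap f x) (ap f y)).
Proof. intros F; apply (cde2 f (fun x y => subset x y) F); d0. Qed.

Lemma cde_lam f a : cde f -> a ∈ lam -> ap f a ∈ lam.
Proof.
intros F Ha; pose proof (ord_in_M a Ha) as HM.
apply (ordinal_mem_stage lam); [apply Hl| |apply cde_mem; auto].
apply (cde2 f (fun x _ => ordinal x) F (D0_ordinal 0) a a HM HM), ord_lam, Ha.
Qed.

(** If [f] moved [a] down to [ap f a], it would also move [ap f a] down, which gives an infinite
    descent. *)
Lemma cde_ordinal_le f a : cde f -> a ∈ lam -> subset a (ap f a).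
Proof.
intros F Ha; apply ordinal_not_mem; auto using ord_lam, cde_lam.
induction a as [a IH] using (well_founded_induction mem_wf); intro H.
pose proof (cde_lam f a F Ha) as Hf.
apply (IH (ap f a) H Hf).
exact (proj1 (cde_in f _ _ F (ord_in_M _ Hf) (ord_in_M a Ha)) H).
Qed.

(** A union of power sets of stages is again a stage; its index is the set of ordinals that belong
    to [y]. *)
Lemma stage_of_stages (H : V -> Prop) y :
  (forall b, H b -> exists d, ordinal d /\ b = stage d) ->
  (forall x, x ∈ y <-> exists b, H b /\ subset x b) ->
  exists d, ordinal d /\ y = stage d.
Proof.
intros HS Hy; pose (g := setof (fun d => d ∈ y /\ ordinal d)).
assert (Hg : forall d, d ∈ g <-> d ∈ y /\ ordinal d).
{ apply (setofP (fun d => d ∈ y /\ ordinal d)), (is_set_sub y); tauto. }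
assert (Og : ordinal g).
{ apply ordinal_of_ordinals; [|intros b Hb; apply Hg, Hb].
  intros d Hd e He; apply Hg in Hd; destruct Hd as [Hd Od]; apply Hg; split.
  - apply Hy in Hd; destruct Hd as [b [Hb S]]; apply Hy; exists b; split; [exact Hb|].
    destruct (HS b Hb) as [c [Oc ->]]; apply (stage_transitive c Oc e), S, He.
  - exact (ordinal_mem d e Od He). }
exists g; split; [exact Og|]; apply V_ext; intro x; split.
- intro Hx; apply Hy in Hx; destruct Hx as [b [Hb S]].
  destruct (HS b Hb) as [c [Oc ->]]; apply (stage_intro g c); [|exact S].
  apply Hg; split; [|exact Oc]; apply Hy; exists (stage c); split; [exact Hb|].
  apply ordinal_subset_stage, Oc.
- intro Hx; apply stageP in Hx; destruct Hx as [d [Hd S]].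
  apply Hg in Hd; destruct Hd as [Hd Od].
  apply Hy in Hd; destruct Hd as [b [Hb Sb]]; apply Hy; exists b; split; [exact Hb|].
  destruct (HS b Hb) as [c [Oc ->]]; intros z Hz; apply S in Hz.
  revert z Hz; apply stage_mono; intros z Hz.
  apply (ordinal_mem_stage c z Oc (ordinal_mem d z Od Hz)), Sb, Hz.
Qed.

(** Montague–Scott style: [y] is some V_d exactly when a [h] satisfying both
    clauses exists, namely h = {V_c | c in d}. *)
Definition history (h : V) : Prop :=
  forall x, x ∈ M -> forall a, a ∈ h ->
    (x ∈ a <-> exists b, b ∈ h /\ (b ∈ a /\ subset x b)).

Definition level (h y : V) : Prop :=
  forall x, x ∈ M -> (x ∈ y <-> exists b, b ∈ h /\ subset x b).

Lemma level_stage h y : h ∈ M -> y ∈ M -> history h -> level h y ->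
  exists d, ordinal d /\ y = stage d.
Proof.
intros Hh Hy HH L; pose proof (stage_transitive lam (proj1 Hl)) as T.
assert (S : forall a, a ∈ h -> exists d, ordinal d /\ a = stage d).
{ intro a; induction a as [a IH] using (well_founded_induction mem_wf); intro Ha.
  apply (stage_of_stages (fun b => b ∈ h /\ b ∈ a)); [intros b []; auto|].
  intro x; split.
  - intro Hx; destruct (proj1 (HH x (T a (T h Hh a Ha) x Hx) a Ha) Hx) as (b & ? & ? & ?).
    eauto.
  - intros (b & (Hb & Hba) & Sx).
    apply (HH x (stage_subset lam b x (T h Hh b Hb) Sx) a Ha); eauto. }
apply (stage_of_stages (fun b => b ∈ h)); [exact S|]; intro x; split.
- intro Hx; exact (proj1 (L x (T y Hy x Hx)) Hx).
- intros (b & Hb & Sx); apply (L x (stage_subset lam b x (T h Hh b Hb) Sx)); eauto.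
Qed.

Lemma stage_level d : d ∈ lam -> exists h, h ∈ M /\ history h /\ level h (stage d).
Proof.
intro Hd; pose proof (ord_lam d Hd) as Od.
destruct (is_set_sub (stage d) (fun b => exists c, c ∈ d /\ b = stage c)) as [h Hh].
{ intros b [c [Hc ->]]; apply stage_mem, Hc. }
exists h; split; [|split].
- apply (stage_intro lam d h Hd); intros b Hb; apply Hh in Hb.
  destruct Hb as [c [Hc ->]]; apply stage_mem, Hc.
- intros x _ a Ha; apply Hh in Ha; destruct Ha as [c [Hc ->]]; split.
  + intro Hx; apply stageP in Hx; destruct Hx as [b [Hb S]].
    exists (stage b); split; [|split; [apply stage_mem, Hb|exact S]].
    apply Hh; exists b; split; [exact (proj1 Od c Hc b Hb)|reflexivity].
  + intros (b & _ & Hbc & S); exact (stage_subset _ b x Hbc S).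
- intros x _; split.
  + intro Hx; apply stageP in Hx; destruct Hx as [b [Hb S]].
    exists (stage b); split; [apply Hh; eauto|exact S].
  + intros (b & Hb & S); apply Hh in Hb; destruct Hb as [c [Hc ->]].
    exact (stage_intro d c x Hc S).
Qed.

(** [history] and [level] are Pi_1, so the image of V_a is some V_d. Since [a] is a subset of V_a
    but not an element, [ap f a] is so related to V_d, whence [d = ap f a]. *)
Lemma cde_stage f a : cde f -> a ∈ lam -> ap f (stage a) = stage (ap f a).
Proof.
intros F Ha; destruct (stage_level a Ha) as (h & Hh & HH & L).
pose proof (stage_mem lam a Ha) as Hs; pose proof (ord_in_M a Ha) as Ha'.
assert (H' : history (ap f h)).
{ refine (cde_forall f (fun x h _ => forall a, a ∈ h ->
    (x ∈ a <-> exists b, b ∈ h /\ (b ∈ a /\ subset x b))) F _ h h Hh Hh HH); d0. }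
assert (L' : level (ap f h) (ap f (stage a))).
{ refine (cde_forall f (fun x h y => x ∈ y <-> exists b, b ∈ h /\ subset x b)
    F _ h (stage a) Hh Hs L); d0. }
destruct (level_stage _ _ (cde_mem f h F Hh) (cde_mem f _ F Hs) H' L') as [d [Od Ed]].
rewrite Ed; f_equal; symmetry.
pose proof (ord_lam _ (cde_lam f a F Ha)) as Ofa; pose proof (ord_lam a Ha) as Oa.
destruct (ordinal_subset (ap f a) d Ofa Od) as [K|K]; auto.
- pose proof (proj1 (cde_subset f _ _ F Ha' Hs) (ordinal_subset_stage a Oa)) as K.
  rewrite Ed in K; intros z Hz; apply (ordinal_mem_stage d z Od); [|apply K, Hz].
  exact (ordinal_mem _ _ Ofa Hz).
- apply (ordinal_mem_stage d _ Od Ofa) in K; rewrite <- Ed in K.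
  apply (cde_in f _ _ F Ha' Hs), (ordinal_mem_stage a a Oa Oa) in K.
  destruct (mem_irrefl a K).
Qed.

(** Let [x] be a subset of V_b with [b] in [k]. Then [ap f x] is a subset of V_(f b) = V_b, whose
    elements are fixed by induction, so [x] and [ap f x] have the same elements. *)
Lemma cde_fix f k : cde f -> ordinal k -> subset k lam ->
  (forall a, a ∈ k -> ap f a = a) -> forall x, x ∈ stage k -> ap f x = x.
Proof.
intros F; induction k as [k IH] using (well_founded_induction mem_wf).
intros Ok S Fk x Hx; pose proof (stage_mono k lam S x Hx) as HxM.
apply stageP in Hx; destruct Hx as [b [Hb Hx]].
assert (Fb : forall y, y ∈ stage b -> ap f y = y).
{ apply IH; auto.
  - exact (ordinal_mem k b Ok Hb).
  - intros z Hz; apply S, (proj1 Ok b Hb z Hz).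
  - intros a Ha; apply Fk, (proj1 Ok b Hb a Ha). }
pose proof (S b Hb) as Hbl; pose proof (stage_mem lam b Hbl) as HbM.
assert (K : subset (ap f x) (stage b)).
{ rewrite <- (Fk b Hb), <- (cde_stage f b F Hbl).
  apply (cde_subset f _ _ F HxM HbM), Hx. }
assert (T : forall y, y ∈ stage b -> y ∈ M).
{ apply stage_mono, (proj1 (proj1 Hl) b Hbl). }
apply V_ext; intro y; split; intro Hy.
- pose proof (K y Hy) as Hyb; rewrite <- (Fb y Hyb) in Hy.
  exact (proj2 (cde_in f y x F (T y Hyb) HxM) Hy).
- pose proof (Hx y Hy) as Hyb; rewrite <- (Fb y Hyb).
  exact (proj1 (cde_in f y x F (T y Hyb) HxM) Hy).
Qed.

(** * Critical points *)

Lemma crit_exists f : cde f -> f <> identity M -> exists k, is_crit lam f k.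
Proof.
intros F N; apply NNPP; intro NC.
assert (K : forall a, a ∈ lam -> ap f a = a).
{ intro a; induction a as [a IH] using (well_founded_induction mem_wf); intro Ha.
  apply NNPP; intro Ne; apply NC; exists a; split; [exact Ha|split; [exact Ne|]].
  intros b Hb; apply IH; [exact Hb|exact (proj1 (proj1 Hl) a Ha b Hb)]. }
apply N, (function_ext f _ M M M (proj1 F) (identity_function M)); intros x Hx.
rewrite (ap_identity M x Hx).
apply (cde_fix f lam F (proj1 Hl)); auto; intros z Hz; exact Hz.
Qed.

Lemma crit_eq f k : is_crit lam f k -> crit lam f = k.
Proof.
intro Hk; pose proof (epsilon_spec (inhabits empty) (is_crit lam f) (ex_intro _ k Hk)) as Hc.
fold (crit lam f) in Hc; destruct Hc as (C1 & C2 & C3), Hk as (K1 & K2 & K3).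
destruct (ordinal_trichotomy _ _ (ord_lam _ C1) (ord_lam _ K1)) as [H|[H|H]]; auto.
- destruct (C2 (K3 _ H)).
- destruct (K2 (C3 _ H)).
Qed.

Lemma crit_spec f : cde f -> f <> identity M -> is_crit lam f (crit lam f).
Proof.
intros F N; destruct (crit_exists f F N) as [k Hk]; rewrite (crit_eq f k Hk); exact Hk.
Qed.

Lemma crit_moved f k : cde f -> is_crit lam f k -> k ∈ ap f k.
Proof.
intros F (K1 & K2 & _).
destruct (ordinal_subset k (ap f k)) as [H|H]; auto using ord_lam, cde_lam, cde_ordinal_le.
congruence.
Qed.

Lemma crit_fix f k x : cde f -> is_crit lam f k -> x ∈ stage k -> ap f x = x.
Proof.
intros F (K1 & _ & K3); apply (cde_fix f k F (ord_lam k K1)); auto.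
exact (proj1 (proj1 Hl) k K1).
Qed.

(** * Restrictions to stages *)

Lemma lam_trans a b : a ∈ lam -> b ∈ a -> b ∈ lam.
Proof. intros Ha; exact (proj1 (proj1 Hl) a Ha b). Qed.

Lemma stage_M a : a ∈ lam -> subset (stage a) M.
Proof. intro Ha; apply stage_mono, (proj1 (proj1 Hl) a Ha). Qed.

Lemma subset_stage_cde f a : cde f -> a ∈ lam -> subset (stage a) (stage (ap f a)).
Proof. intros F Ha; apply stage_mono, cde_ordinal_le; assumption. Qed.

Lemma opair_restrict_stage k a x y : cde k -> a ∈ lam -> x ∈ stage a ->
  (opair x y ∈ restrict k (stage a) <-> y = ap k x).
Proof.
intros K Ha Hx.
rewrite opair_restrict, (opair_ap k M M) by (apply K || apply (stage_M a Ha x Hx)).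
tauto.
Qed.

Lemma restrict_function k a : cde k -> a ∈ lam ->
  is_function (restrict k (stage a)) (stage a) (stage (ap k a)).
Proof.
intros K Ha.
assert (Hk : forall x, x ∈ stage a -> ap k x ∈ stage (ap k a)).
{ intros x Hx; rewrite <- cde_stage by assumption.
  exact (proj1 (cde_in k _ _ K (stage_M a Ha x Hx) (stage_mem lam a Ha)) Hx). }
split.
- intros z Hz; apply restrictP in Hz as Hz'.
  destruct Hz' as [_ (x & y & Hx & ->)]; exists x, y.
  apply (opair_restrict_stage k a x y K Ha Hx) in Hz; subst y; auto.
- intros x Hx; exists (ap k x).
  split; [|intros y Hy; symmetry]; apply (opair_restrict_stage k a x _ K Ha Hx); auto.
Qed.

(** This lets another map act on [k|V_a]. Both coordinates of its pairs lie in V_(k a), because [a]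
    is at most [ap k a]. *)
Lemma restrict_M k a : cde k -> a ∈ lam -> restrict k (stage a) ∈ M.
Proof.
intros K Ha; pose proof (cde_lam k a K Ha) as Hk.
apply (stage_intro lam (succ (succ (ap k a)))); [auto using limit_succ|].
intros z Hz; destruct (proj1 (restrict_function k a K Ha) z Hz) as (x & y & Hx & Hy & ->).
apply opair_stage_succ; [apply (subset_stage_cde k a K Ha), Hx|exact Hy].
Qed.

(** * Application *)

Definition image (f k a : V) : V := ap f (restrict k (stage a)).

Lemma image_function f k a : cde f -> cde k -> a ∈ lam ->
  is_function (image f k a) (stage (ap f a)) (stage (ap f (ap k a))).
Proof.
intros F K Ha; pose proof (cde_lam k a K Ha) as Hka.
rewrite <- (cde_stage f a F Ha), <- (cde_stage f _ F Hka).
refine (proj1 (cde3 f is_function F (D0_function 0 1 2) _ _ _ _ _ _) _);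
  auto using stage_mem, cde_lam, restrict_M, restrict_function.
Qed.

Lemma image_mono f k a b : cde f -> cde k -> a ∈ lam -> b ∈ lam -> subset a b ->
  subset (image f k a) (image f k b).
Proof.
intros F K Ha Hb S.
refine (proj1 (cde_subset f _ _ F _ _) _); auto using restrict_M.
intros z Hz; apply restrictP in Hz; apply restrictP; destruct Hz as [Hz (x & y & Hx & E)].
split; [exact Hz|exists x, y; split; [exact (stage_mono a b S x Hx)|exact E]].
Qed.

Lemma appP f k z : z ∈ app lam f k <-> exists a, a ∈ lam /\ z ∈ image f k a.
Proof.
apply (setofP (fun z => exists a, a ∈ lam /\ z ∈ image f k a)).
apply (is_set_union lam (fun a z => z ∈ image f k a)).
intros a _; exists (image f k a); reflexivity.
Qed.

(** The pieces [image f k a] are functions that increase with [a], and their domains V_(f a) contain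
    V_a, hence cover V_lam. *)
Lemma app_function f k : cde f -> cde k -> is_function (app lam f k) M M.
Proof.
intros F K; split.
- intros z Hz; apply appP in Hz; destruct Hz as [a [Ha Hz]].
  destruct (proj1 (image_function f k a F K Ha) z Hz) as (x & y & Hx & Hy & E).
  exists x, y; repeat split; [| |exact E].
  + apply (stage_M (ap f a)); auto using cde_lam.
  + apply (stage_M (ap f (ap k a))); auto using cde_lam.
- intros x Hx; destruct (stage_limit lam x Hl Hx) as [a [Ha Hxa]].
  apply (subset_stage_cde f a F Ha) in Hxa.
  pose proof (ap_pair _ _ _ x (image_function f k a F K Ha) Hxa) as Hp.
  exists (ap (image f k a) x); split; [apply appP; eauto|].
  intros y Hy; apply appP in Hy; destruct Hy as [b [Hb Hy]].
  destruct (ordinal_max lam a b (proj1 Hl) Ha Hb) as (d & Hd & Sa & Sb).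
  apply (image_mono f k a d F K Ha Hd Sa) in Hp.
  apply (image_mono f k b d F K Hb Hd Sb) in Hy.
  pose proof (image_function f k d F K Hd) as Fd.
  rewrite <- (ap_eq _ _ _ _ _ Fd Hp); exact (ap_eq _ _ _ _ _ Fd Hy).
Qed.

Lemma ap_app_image f k a x : cde f -> cde k -> a ∈ lam -> x ∈ stage (ap f a) ->
  ap (app lam f k) x = ap (image f k a) x.
Proof.
intros F K Ha Hx; apply (ap_eq _ M M); [apply app_function; assumption|].
apply appP; exists a; split; [exact Ha|].
exact (ap_pair _ _ _ x (image_function f k a F K Ha) Hx).
Qed.

Lemma restrict_app f k a : cde f -> cde k -> a ∈ lam ->
  restrict (app lam f k) (stage (ap f a)) = image f k a.
Proof.
intros F K Ha; pose proof (image_function f k a F K Ha) as I.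
assert (A : forall x y, x ∈ stage (ap f a) ->
  (opair x y ∈ app lam f k <-> opair x y ∈ image f k a)).
{ intros x y Hx.
  rewrite (opair_ap _ _ _ x y I Hx), <- (ap_app_image f k a x F K Ha Hx).
  apply (opair_ap _ M M); [apply app_function; assumption|].
  apply (stage_M (ap f a)); auto using cde_lam. }
apply V_ext; intro z; rewrite restrictP; split.
- intros [Hz (x & y & Hx & ->)]; apply A; assumption.
- intro Hz; destruct (proj1 I z Hz) as (x & y & Hx & _ & ->).
  split; [apply A; assumption|eauto].
Qed.

(** Apply [f] to the statement that the pair of [x] and [ap k x] belongs to [k|V_a]. *)
Lemma ap_app f k x : cde f -> cde k -> x ∈ M ->
  ap (app lam f k) (ap f x) = ap f (ap k x).
Proof.
intros F K Hx; destruct (stage_limit lam x Hl Hx) as [a [Ha Hxa]].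
apply (ap_eq _ M M); [apply app_function; assumption|].
apply appP; exists a; split; [exact Ha|].
refine (proj1 (cde3 f (fun x y r => opair x y ∈ r) F (D0_opair_mem 0 1 2)
  _ _ _ _ _ _) _); auto using restrict_M, cde_mem.
apply opair_restrict_stage; auto.
Qed.

Lemma D0_finite N (P : nat -> (nat -> V) -> Prop) :
  (forall n, D0 (P n)) -> D0 (fun e => forall n, n < N -> P n e).
Proof.
intro H; induction N as [|N IH].
- apply (D0_iff _ _ (D0_not _ D0_false)); intro e; split; [lia|tauto].
- apply (D0_iff _ _ (D0_and _ _ IH (H N))); intro e; split.
  + intros [A B] n Hn; destruct (Nat.eq_dec n N) as [->|]; [exact B|apply A; lia].
  + intro A; split; [intros n Hn; apply A; lia|apply A; lia].
Qed.

(** That [k|V_c] preserves the single predicate [P] is a Delta_0 statement about [k|V_c] and V_(k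
    c). The map [f] carries it over to [image f k c], which agrees with [app lam f k] on V_(f c). *)
Lemma app_D0 f k P e : cde f -> cde k -> D0 P -> (forall n, e n ∈ M) ->
  (P e <-> P (fun n => ap (app lam f k) (e n))).
Proof.
intros F K D He; destruct (D0_support P D) as [N S].
destruct (stage_limit_fin lam e (Datatypes.S N) Hl He) as (c & Hc & Hec).
pose proof (cde_lam k c K Hc) as Hkc.
pose (A := stage (ap k c)); pose (g := restrict k (stage c)).
(* Position 0 holds the graph; arguments and values alternate from position 2 on, after the two
   parameters of [cde_env]. *)
assert (DR : D0 (fun E =>
  (forall n, n < N -> opair (E (2 + 2 * n)) (E (3 + 2 * n)) ∈ E 0) ->
  (P (fun n => E (2 + 2 * n)) <-> P (fun n => E (3 + 2 * n))))).
{ apply D0_imp; [apply (D0_finite N (fun n E => opair (E (2 + 2 * n)) (E (3 + 2 * n)) ∈ E 0))|].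
  - intro n; apply D0_opair_mem.
  - apply D0_equiv; [apply (D0_rename P (fun n => 2 + 2 * n) D)
                    |apply (D0_rename P (fun n => 3 + 2 * n) D)]. }
assert (HA : forall n, n < Datatypes.S N -> e n ∈ A).
{ intros n Hn; apply (subset_stage_cde k c K Hc), Hec, Hn. }
assert (T : forall e', (forall n, e' n ∈ ap f A) ->
  (forall n, n < N -> opair (e' (2 * n)) (e' (1 + 2 * n)) ∈ ap f g) ->
  (P (fun n => e' (2 * n)) <-> P (fun n => e' (1 + 2 * n)))).
{ refine (cde_env f _ A g g F DR (stage_mem lam _ Hkc) (restrict_M k c K Hc)
            (restrict_M k c K Hc) (ex_intro _ (e 0) (HA 0 ltac:(lia))) _).
  intros e' He' Hp.
  assert (He'' : forall n, e' (2 * n) ∈ M) by (intro n; apply (stage_M _ Hkc), He').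
  refine (iff_trans (proj1 (proj2 K) P D (fun n => e' (2 * n)) He'') _).
  apply S; intros n Hn; change (ap k (e' (2 * n)) = e' (1 + 2 * n)).
  specialize (Hp n Hn); apply (ap_eq k M M); [apply K|].
  exact (proj1 (proj1 (opair_restrict k (stage c) (e' (2 * n)) (e' (1 + 2 * n))) Hp)). }
pose proof (image_function f k c F K Hc) as I.
(* Arguments at even and values at odd positions; capping the index at [N] keeps the whole sequence
   among entries known to lie in V_c, and their values. *)
pose (e' := fun m => let x := e (Nat.min (Nat.div2 m) N) in
            if Nat.even m then x else ap (app lam f k) x).
assert (Ev : forall n, e' (2 * n) = e (Nat.min n N)).
{ intro n; unfold e'; rewrite Nat.even_mul, Nat.div2_double; reflexivity. }
assert (Od : forall n, e' (1 + 2 * n) = ap (app lam f k) (e (Nat.min n N))).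
{ intro n; unfold e'; change (1 + 2 * n) with (Datatypes.S (2 * n)).
  rewrite Nat.even_succ, Nat.odd_mul, Nat.div2_succ_double; reflexivity. }
assert (Hmin : forall n, e (Nat.min n N) ∈ stage (ap f c)).
{ intro n; apply (subset_stage_cde f c F Hc), Hec; lia. }
rewrite (S e (fun n => e' (2 * n))), (S (fun n => ap _ (e n)) (fun n => e' (1 + 2 * n))).
- apply T.
  + intro m; unfold A; rewrite cde_stage by assumption; unfold e'.
    destruct (Nat.even m).
    * apply (subset_stage_cde f _ F Hkc), HA; lia.
    * rewrite (ap_app_image f k c) by auto; apply (ap_mem _ _ _ _ I), Hmin.
  + intros n Hn; rewrite Ev, Od, (ap_app_image f k c) by auto.
    exact (ap_pair _ _ _ _ I (Hmin n)).
- intros n Hn; rewrite Od; do 2 f_equal; lia.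
- intros n Hn; rewrite Ev; f_equal; lia.
Qed.

Lemma app_cde f k : cde f -> cde k -> cde (app lam f k).
Proof.
intros F K; split; [apply app_function; assumption|split].
- intros P D e He; apply app_D0; assumption.
- intros x Hx; destruct (stage_limit lam x Hl Hx) as [a [Ha Hxa]].
  pose proof (stage_mem lam a Ha) as Hs; pose proof (cde_lam k a K Ha) as Hka.
  (* The value here is [f (k V_a)], that is V_(f (k a)), which contains V_a. *)
  exists (ap f (stage a)); split; [apply cde_mem; assumption|].
  rewrite ap_app, !cde_stage by assumption.
  apply (subset_stage_cde f _ F Hka), (subset_stage_cde k a K Ha), Hxa.
Qed.

(** * Fixed points, critical points and the laws of application *)

Lemma app_fix f k a x : cde f -> cde k -> a ∈ lam ->
  (forall y, y ∈ stage a -> ap k y = y) ->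
  x ∈ stage (ap f a) -> ap (app lam f k) x = x.
Proof.
intros F K Ha Fk Hx; rewrite (ap_app_image f k a) by assumption.
apply (ap_eq _ _ _ _ _ (image_function f k a F K Ha)).
assert (D : D0 (fun e => forall x, x ∈ e 0 -> opair x x ∈ e 1)) by d0.
rewrite <- cde_stage in Hx by assumption; revert x Hx.
refine (proj1 (cde2 f (fun s r => forall x, x ∈ s -> opair x x ∈ r) F D _ _ _ _) _);
  auto using stage_mem, restrict_M.
intros y Hy; apply opair_restrict_stage; auto; symmetry; auto.
Qed.

(** Below [ap f c] use [app_fix]; [ap f c] itself goes to [f (k c)], which differs from [f c]
    because [f] is injective. *)
Lemma app_crit f k c : cde f -> cde k -> is_crit lam k c ->
  is_crit lam (app lam f k) (ap f c).
Proof.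
intros F K C; destruct C as (C1 & C2 & C3).
split; [apply cde_lam; assumption|split].
- rewrite ap_app by auto using ord_in_M; intro E; apply C2.
  apply (cde_eq f _ _ F); auto using cde_mem, ord_in_M.
- intros a Ha; apply (app_fix f k c); auto.
  + intros y Hy; apply (crit_fix k c); [exact K|split; auto|exact Hy].
  + apply ordinal_subset_stage; auto using ord_lam, cde_lam.
Qed.

Lemma app_nontrivial f k : cde f -> cde k -> k <> identity M ->
  app lam f k <> identity M.
Proof.
intros F K N E; pose proof (app_crit f k _ F K (crit_spec k K N)) as (C1 & C2 & _).
apply C2; rewrite E; apply ap_identity, ord_in_M, C1.
Qed.

Lemma identity_Emb : Emb lam (identity M).
Proof.
split; [apply identity_function|]; intros p e He.
replace (fun n => ap (identity M) (e n)) with e; [reflexivity|].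
apply functional_extensionality; intro n; symmetry; apply ap_identity, He.
Qed.

Lemma app_identity_l k : cde k -> app lam (identity M) k = k.
Proof.
intro K; pose proof (Emb_cde _ identity_Emb) as I.
apply (function_ext _ _ M M M (app_function _ _ I K) (proj1 K)); intros x Hx.
rewrite <- (ap_identity M x Hx) at 1; rewrite ap_app by assumption.
apply ap_identity, cde_mem; assumption.
Qed.

Lemma app_identity_r f : cde f -> app lam f (identity M) = identity M.
Proof.
intro F; pose proof (Emb_cde _ identity_Emb) as I.
apply (function_ext _ _ M M M (app_function _ _ F I) (proj1 I)); intros x Hx.
destruct (stage_limit lam x Hl Hx) as [a [Ha Hxa]].
rewrite (ap_identity M x Hx); apply (app_fix f _ a); auto.
- intros y Hy; apply ap_identity, (stage_M a Ha), Hy.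
- apply (subset_stage_cde f a F Ha), Hxa.
Qed.

(** Both sides extend [f (g (h|V_a))], whose domain is [f (g V_a)]. *)
Lemma app_distributive f g h : cde f -> cde g -> cde h ->
  app lam f (app lam g h) = app lam (app lam f g) (app lam f h).
Proof.
intros F G H.
pose proof (app_cde f g F G) as FG; pose proof (app_cde f h F H) as FH.
pose proof (app_cde g h G H) as GH.
apply (function_ext _ _ M M M); [apply app_function; assumption..|].
intros x Hx; destruct (stage_limit lam x Hl Hx) as [a [Ha Hxa]].
pose proof (cde_lam g a G Ha) as Hga; pose proof (cde_lam f a F Ha) as Hfa.
apply (subset_stage_cde g a G Ha), (subset_stage_cde f _ F Hga) in Hxa.
rewrite (ap_app_image f (app lam g h) (ap g a)) by assumption.
rewrite (ap_app_image (app lam f g) (app lam f h) (ap f a));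
  [|assumption..|rewrite ap_app; auto using ord_in_M].
(* The right side becomes [f * g] applied to [f (h|V_a)], which [ap_app] turns into
   [f (g (h|V_a))]. *)
unfold image; rewrite !restrict_app by assumption; unfold image.
rewrite ap_app; auto using restrict_M.
Qed.

(** * Elementary chains *)

Definition elementary_substructure (A B : V) : Prop :=
  subset A B /\
  forall p e, (forall n, e n ∈ A) -> (sat A p e <-> sat B p e).

(** For each single formula, elementarity of [A] in [B] is a Delta_0 property of the two sets. *)
Lemma elementary_substructure_cde f A B :
  cde f -> A ∈ M -> B ∈ M -> (exists x, x ∈ A) ->
  elementary_substructure A B -> elementary_substructure (ap f A) (ap f B).
Proof.
intros F HA HB NA [S E]; split; [apply (cde_subset f A B F); assumption|].
intros p e He.
assert (D : D0 (fun e => sat (e 0) p (fun n => e (2 + n)) <->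
                         sat (e 1) p (fun n => e (2 + n)))).
{ apply D0_equiv; apply D0_sat. }
exact (cde_env f _ A A B F D HA HA HB NA (fun e He => E p e He) e He).
Qed.

Record chain (A : nat -> V) : Prop := {
  chain_M n : A n ∈ M;
  chain_transitive n : transitive (A n);
  chain_inhabited n : exists x, x ∈ A n;
  chain_step n : elementary_substructure (A n) (A (S n));
  chain_cover x : x ∈ M -> exists n, x ∈ A n }.

(** The images cover V_lam by cofinality: [x] lies in some [ap f y], [y] lies in some [A n], and
    [ap f (A n)] is transitive. *)
Lemma chain_cde f A : cde f -> chain A -> chain (fun n => ap f (A n)).
Proof.
intros F C; split.
- intro n; apply cde_mem; [exact F|apply C].
- intro n; pose proof (chain_M A C n) as H.
  apply (cde2 f (fun x _ => transitive x) F (D0_transitive 0) _ _ H H), C.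
- intro n; destruct (chain_inhabited A C n) as [x Hx]; exists (ap f x).
  pose proof (stage_transitive lam (proj1 Hl) _ (chain_M A C n) x Hx) as HxM.
  exact (proj1 (cde_in f _ _ F HxM (chain_M A C n)) Hx).
- intro n; apply elementary_substructure_cde; try apply C; exact F.
- intros x Hx; destruct (proj2 (proj2 F) x Hx) as [y [Hy Hxy]].
  destruct (chain_cover A C y Hy) as [n Hn]; exists n.
  pose proof (chain_M A C n) as HA.
  apply (cde2 f (fun x _ => transitive x) F (D0_transitive 0) _ _ HA HA) with (ap f y).
  + apply C.
  + exact (proj1 (cde_in f _ _ F Hy HA) Hn).
  + exact Hxy.
Qed.

Lemma chain_le A m n : chain A -> m <= n -> elementary_substructure (A m) (A n).
Proof.
intros C; induction 1 as [|n _ [S E]].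
- split; [intros x Hx; exact Hx|reflexivity].
- destruct (chain_step A C n) as [S' E']; split.
  + intros x Hx; apply S', S, Hx.
  + intros p e He; rewrite (E p e He); apply E'; intro i; apply S, He.
Qed.

(** Tarski's elementary chain theorem. For a quantifier, a witness in some [A m] is treated inside
    [A (n + m)]. *)
Lemma chain_sat A p n e : chain A -> (forall i, e i ∈ A n) ->
  (sat (A n) p e <-> sat M p e).
Proof.
intro C; revert n e; induction p as [i j|i j| |p IHp q IHq|p IH]; intros n e He;
  try reflexivity; simpl.
- rewrite (IHp n e He), (IHq n e He); reflexivity.
- split; intros H x Hx.
  + destruct (chain_cover A C x Hx) as [m Hm].
    destruct (chain_le A n (n + m) C ltac:(lia)) as [S E].
    destruct (chain_le A m (n + m) C ltac:(lia)) as [S' _].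
    apply (IH (n + m)); [intros [|i]; simpl; auto|].
    exact (proj1 (E (fAll p) e He) H x (S' x Hm)).
  + apply IH; [intros [|i]; simpl; auto|].
    apply H, (stage_transitive lam (proj1 Hl) _ (chain_M A C n)), Hx.
Qed.

Lemma sat_support p : exists N, forall A e e',
  (forall n, n < N -> e n = e' n) -> (sat A p e <-> sat A p e').
Proof.
destruct (D0_support _ (D0_sat p 0 S)) as [N H]; exists N; intros A e e' E.
apply (H (scons A e) (scons A e')); intros [|n] Hn; simpl; [reflexivity|].
apply E; lia.
Qed.

(** Truth in V_lam is truth in some [A m], a Delta_0 statement that [k] carries to [ap k (A m)];
    this is a member of the image chain, so truth there is again truth in V_lam. *)
Lemma chain_Emb A k : chain A -> cde k -> Emb lam k.
Proof.
intros C K; split; [apply K|]; intros p e He.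
destruct (sat_support p) as [N S].
assert (Fin : exists m, forall n, n < Datatypes.S N -> e n ∈ A m).
{ generalize (Datatypes.S N) as L; induction L as [|L [m IH]]; [exists 0; lia|].
  destruct (chain_cover A C _ (He L)) as [l Hl']; exists (m + l); intros n Hn.
  destruct (Nat.eq_dec n L) as [->|].
  - apply (chain_le A l (m + l) C ltac:(lia)), Hl'.
  - apply (chain_le A m (m + l) C ltac:(lia)), IH; lia. }
(* Capping the index puts all entries into the single set [A m] without changing those that [p] can
   see. *)
destruct Fin as [m Hm]; pose (e1 := fun n => e (Nat.min n N)).
assert (H1 : forall n, e1 n ∈ A m) by (intro n; apply Hm; lia).
rewrite (S M e e1) by (intros n Hn; unfold e1; f_equal; lia).
rewrite (S M (fun n => ap k (e n)) (fun n => ap k (e1 n)))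
  by (intros n Hn; unfold e1; do 2 f_equal; lia).
rewrite <- (chain_sat A p m e1 C H1).
assert (H2 : forall n, ap k (e1 n) ∈ ap k (A m)).
{ intro n; exact (proj1 (cde_in k _ _ K (He _) (chain_M A C m)) (H1 n)). }
rewrite <- (chain_sat _ p m _ (chain_cde k A K C) H2).
apply (proj1 (proj2 K) _ (D0_sat p 0 Datatypes.S) (scons (A m) e1)).
intros [|n]; [apply C|apply He].
Qed.

(** * The critical sequence and closure under application *)

Lemma sup_seqP f x : (forall n, f n ∈ lam) -> (x ∈ sup_seq f <-> exists n, x ∈ f n).
Proof.
intro H; apply (setofP (fun x => exists n, x ∈ f n)), (is_set_sub lam).
intros y [n Hy]; exact (lam_trans _ _ (H n) Hy).
Qed.

Lemma left_power_cde j n : (forall n, cde (j n)) -> cde (left_power lam j n).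
Proof. intro H; induction n; simpl; auto using app_cde. Qed.

(** [crit (j_(n+1)) = j_(n) (k_0) <= k_(n+1)] for the left powers [j_(n)] of [j]
    and the critical sequence [k_n = j^n (crit j)], so that the latter is cofinal
    by the Laver-Steel theorem. *)
Lemma critical_sequence_cofinal j k : laver_steel lam -> Emb lam j -> is_crit lam j k ->
  forall a, a ∈ lam -> exists n, a ∈ Nat.iter n (ap j) k.
Proof.
intros LS J C; pose proof (Emb_cde j J) as Jc; pose (K := fun n => Nat.iter n (ap j) k).
pose (L := left_power lam (fun _ => j)).
assert (Lc : forall n, cde (L n)) by (intro n; apply left_power_cde; auto).
assert (HK : forall n, K n ∈ lam).
{ intro n; induction n; [apply C|exact (cde_lam j _ Jc IHn)]. }
assert (B : forall n m, subset (ap (L n) (K m)) (K (S (n + m)))).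
{ induction n as [|n IH]; intro m; [intros z Hz; exact Hz|].
  intros z Hz; replace (S (S n + m)) with (S (n + S m)) by lia; apply IH.
  (* As [L (S n)] is [L n * j], the value of [L n] at [j (K m)] is that of [L (S n)] at [L n (K m)],
     and [K m] is at most [L n (K m)]. *)
  change (K (S m)) with (ap j (K m)); rewrite <- ap_app by auto using ord_in_M.
  refine (proj1 (cde_subset (L (S n)) _ _ (Lc (S n)) _ _) _ z Hz);
    auto using ord_in_M, cde_lam, cde_ordinal_le. }
assert (CL : forall n, exists c, is_crit lam (L n) c /\ subset c (K n)).
{ intros [|n].
  - exists k; split; [exact C|intros z Hz; exact Hz].
  - exists (ap (L n) k); split; [apply app_crit; auto|].
    pose proof (B n 0) as H; rewrite Nat.add_0_r in H; exact H. }
assert (N : j <> identity M).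
{ intro E; apply (proj1 (proj2 C)); rewrite E; apply ap_identity, ord_in_M, C. }
intros a Ha; rewrite <- (LS (fun _ => j) (fun _ => conj J N)) in Ha.
apply sup_seqP in Ha.
- destruct Ha as [n Hn]; destruct (CL n) as [c [Hc S]]; exists n.
  apply S; rewrite <- (crit_eq _ c Hc); exact Hn.
- intro n; destruct (CL n) as [c [Hc _]]; fold (L n); rewrite (crit_eq _ c Hc); apply Hc.
Qed.

(** The empty set is mapped to the empty set, whereas [k] belongs to [ap j k]. *)
Lemma crit_inhabited j k : cde j -> is_crit lam j k -> exists x, x ∈ k.
Proof.
intros J C; apply NNPP; intro N.
assert (D : D0 (fun e => forall x, x ∈ e 0 -> False)) by (apply D0_all, D0_false).
pose proof (ord_in_M k (proj1 C)) as Hk.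
apply (proj1 (cde2 j (fun y _ => forall x, x ∈ y -> False) J D k k Hk Hk)) with k.
- intros x Hx; apply N; exists x; exact Hx.
- apply crit_moved; assumption.
Qed.

(** V_k is elementary in its image V_(j k) because [j] fixes V_k pointwise; applying [j] repeatedly
    gives the later steps. *)
Lemma critical_chain j k : laver_steel lam -> Emb lam j -> is_crit lam j k ->
  chain (fun n => stage (Nat.iter n (ap j) k)).
Proof.
intros LS J C; pose proof (Emb_cde j J) as Jc.
assert (HK : forall n, Nat.iter n (ap j) k ∈ lam).
{ intro n; induction n; [apply C|exact (cde_lam j _ Jc IHn)]. }
assert (NE : forall n, exists x, x ∈ stage (Nat.iter n (ap j) k)).
{ intro n; induction n as [|n [x Hx]].
  - destruct (crit_inhabited j k Jc C) as [x Hx]; exists x.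
    apply ordinal_subset_stage; [apply ord_lam, C|exact Hx].
  - exists x; exact (subset_stage_cde j _ Jc (HK n) x Hx). }
split; auto.
- intro n; apply stage_mem, HK.
- intro n; apply stage_transitive, ord_lam, HK.
- intro n; induction n as [|n IH].
  + split; [exact (subset_stage_cde j k Jc (HK 0))|]; intros p e He; simpl.
    assert (Ee : (fun n => ap j (e n)) = e).
    { apply functional_extensionality; intro n; apply (crit_fix j k); auto. }
    rewrite <- Ee at 2; rewrite <- (cde_stage j k Jc (HK 0)).
    apply (proj1 (proj2 Jc) _ (D0_sat p 0 S) (scons (stage k) e)).
    intros [|n]; [apply stage_mem, C|exact (stage_M k (HK 0) _ (He n))].
  + pose proof (elementary_substructure_cde j _ _ Jc (stage_mem lam _ (HK n))
      (stage_mem lam _ (HK (S n))) (NE n) IH) as H.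
    rewrite !cde_stage in H by (exact Jc || apply HK); exact H.
- intros x Hx; apply stageP in Hx; destruct Hx as [b [Hb Hx]].
  destruct (critical_sequence_cofinal j k LS J C b Hb) as [n Hn]; exists n.
  exact (stage_intro _ b x Hn Hx).
Qed.

(** For non-trivial [j] the chain built from [j] makes every map satisfying [cde] elementary, and
    [app lam j k] is such a map. *)
Lemma Emb_app j k : laver_steel lam -> Emb lam j -> Emb lam k -> Emb lam (app lam j k).
Proof.
intros LS J K; pose proof (Emb_cde j J) as Jc; pose proof (Emb_cde k K) as Kc.
destruct (classic (j = identity M)) as [->|N].
- rewrite app_identity_l; assumption.
- apply (chain_Emb _ _ (critical_chain j _ LS J (crit_spec j Jc N))), app_cde; assumption.
Qed.

(** * The congruence and the Fibonacci terms *)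

Section Congruence.

Context (gam : V) (Hg : limit_ordinal gam) (Hgl : gam ∈ lam).

Lemma agree_refl j : agree gam j j.
Proof. intros x _; reflexivity. Qed.

Lemma agree_sym j k : agree gam j k -> agree gam k j.
Proof. intros A x Hx; symmetry; apply A, Hx. Qed.

Lemma agree_trans i j k : agree gam i j -> agree gam j k -> agree gam i k.
Proof. intros A B x Hx; rewrite (A x Hx); apply B, Hx. Qed.

Lemma agree_mem j k x y : agree gam j k -> x ∈ stage gam -> y ∈ stage gam ->
  y ∈ ap j x -> y ∈ ap k x.
Proof.
intros A Hx Hy H; apply (interP (ap k x) (stage gam)).
rewrite <- (A x Hx); apply interP; auto.
Qed.

(** A substitute for [k|V_a] that records only the part of each value inside V_a; for [a] in [gam]
    it lies in V_gam and depends only on the class of [k]. *)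
Definition local_graph (k a : V) : V :=
  setof (fun z => exists u v, u ∈ stage a /\ v ∈ stage a /\ v ∈ ap k u /\ z = opair u v).

Lemma local_graphP k a z : z ∈ local_graph k a <->
  exists u v, u ∈ stage a /\ v ∈ stage a /\ v ∈ ap k u /\ z = opair u v.
Proof.
apply (setofP (fun z =>
  exists u v, u ∈ stage a /\ v ∈ stage a /\ v ∈ ap k u /\ z = opair u v)).
apply (is_set_sub (stage (succ (succ a)))); intros y (u & v & Hu & Hv & _ & ->).
apply opair_stage_succ; assumption.
Qed.

Lemma local_graph_stage k a b : limit_ordinal b -> a ∈ b -> local_graph k a ∈ stage b.
Proof.
intros Hb Ha; apply (stage_intro b (succ (succ a))); [auto using limit_succ|].
intros z Hz; apply local_graphP in Hz; destruct Hz as (u & v & Hu & Hv & _ & ->).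
apply opair_stage_succ; assumption.
Qed.

(** The relation between [local_graph k a] and [k|V_a] is Delta_0 once the value [w] is quantified
    over V_(k a), so [f] preserves it. *)
Lemma local_graph_app f k a x y : cde f -> cde k -> a ∈ lam ->
  x ∈ stage a -> y ∈ stage a ->
  (opair x y ∈ ap f (local_graph k a) <-> y ∈ ap (app lam f k) x).
Proof.
intros F K Ha Hx Hy; pose proof (cde_lam k a K Ha) as Hka.
assert (D : D0 (fun e => forall u, u ∈ e 0 -> forall v, v ∈ e 0 -> forall w, w ∈ e 3 ->
  opair u w ∈ e 2 -> (opair u v ∈ e 1 <-> v ∈ w))) by d0.
apply (subset_stage_cde f a F Ha) in Hx, Hy.
rewrite (ap_app_image f k a x F K Ha Hx).
pose proof (image_function f k a F K Ha) as I.
pose proof (ap_pair _ _ _ x I Hx) as Hp; pose proof (ap_mem _ _ _ x I Hx) as Hw.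
revert Hp; rewrite <- cde_stage in Hx, Hy, Hw by assumption.
revert x Hx y Hy Hw; intros x Hx y Hy; generalize (ap (image f k a) x) as w; intros w Hw.
revert x Hx y Hy w Hw.
refine (proj1 (cde4 f (fun s r g c => forall u, u ∈ s -> forall v, v ∈ s ->
  forall w, w ∈ c -> opair u w ∈ g -> (opair u v ∈ r <-> v ∈ w)) F D
  (stage a) (local_graph k a) (restrict k (stage a)) (stage (ap k a)) _ _ _ _) _);
  auto using stage_mem, restrict_M, local_graph_stage.
intros u Hu v Hv w _ Huw; apply (opair_restrict_stage k a u w K Ha Hu) in Huw; subst w.
rewrite local_graphP; split; [|eauto 6].
intros (u' & v' & _ & _ & H & E); apply opair_inj in E; destruct E as [-> ->]; exact H.
Qed.

Lemma local_graph_agree k k' a : a ∈ gam -> agree gam k k' ->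
  local_graph k a = local_graph k' a.
Proof.
intros Ha A; assert (S : subset (stage a) (stage gam)) by apply stage_mono, (proj1 (proj1 Hg) a Ha).
apply V_ext; intro z; rewrite !local_graphP.
split; intros (u & v & Hu & Hv & H & ->); exists u, v; repeat split; auto.
- apply (agree_mem k k'); auto.
- apply (agree_mem k' k); auto using agree_sym.
Qed.

Lemma agree_app f f' k k' : cde f -> cde f' -> cde k -> cde k' ->
  agree gam f f' -> agree gam k k' -> agree gam (app lam f k) (app lam f' k').
Proof.
assert (W : forall f f' k k' x y, cde f -> cde f' -> cde k -> cde k' ->
  agree gam f f' -> agree gam k k' -> x ∈ stage gam -> y ∈ stage gam ->
  y ∈ ap (app lam f k) x -> y ∈ ap (app lam f' k') x).
{ clear f f' k k'; intros f f' k k' x y F F' K K' A B Hx Hy H.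
  destruct (stage_limit2 gam x y Hg Hx Hy) as (a & Ha & Hxa & Hya).
  pose proof (lam_trans _ _ Hgl Ha) as Hal.
  apply (local_graph_app f k a) in H; auto.
  apply (local_graph_app f' k' a); auto.
  (* The local graphs of [k] and [k'] coincide; both this set and the pair lie in V_gam, so [f] may
     then be exchanged for [f']. *)
  rewrite <- (local_graph_agree k k' a Ha B).
  apply (agree_mem f f'); auto using local_graph_stage, opair_stage. }
intros F F' K K' A B x Hx; apply V_ext; intro y; rewrite !interP.
split; intros [H Hy]; split; auto.
- apply (W f f' k k'); assumption.
- apply (W f' f k' k); auto using agree_sym.
Qed.

Lemma crit_agree_identity j c : cde j -> is_crit lam j c -> subset gam c ->
  agree gam j (identity M).
Proof.
intros J C S x Hx; rewrite (crit_fix j c x J C), ap_identity; [reflexivity| |].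
- apply (stage_M gam Hgl), Hx.
- apply (stage_mono gam c S), Hx.
Qed.

(** If [c], the critical point of [j], were below [gam], then from [c] in [j c] agreement would put
    [c] into [(j * j) c]. But [j * j] has critical point [j c] and so fixes [c]. *)
Lemma agree_square j : cde j -> agree gam (app lam j j) j -> agree gam j (identity M).
Proof.
intros J A; destruct (classic (j = identity M)) as [->|N]; [apply agree_refl|].
pose proof (crit_spec j J N) as C; set (c := crit lam j) in *.
pose proof (ord_lam c (proj1 C)) as Oc; pose proof (ord_lam gam Hgl) as Og.
apply (crit_agree_identity j c J C), ordinal_not_mem; auto.
intro Hc; pose proof (ordinal_subset_stage gam Og c Hc) as Hcs.
pose proof (crit_moved j c J C) as Hm.
apply (agree_mem j (app lam j j) c c (agree_sym _ _ A) Hcs Hcs) in Hm.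
destruct (app_crit j j c J J C) as (_ & _ & Fix).
rewrite (Fix c (crit_moved j c J C)) in Hm; exact (mem_irrefl c Hm).
Qed.

(** * Fibonacci terms *)

Lemma fib_term_nontrivial j k n : laver_steel lam ->
  Emb lam j /\ j <> identity M -> Emb lam k /\ k <> identity M ->
  Emb lam (fib_term (app lam) (S n) j k) /\
  fib_term (app lam) (S n) j k <> identity M.
Proof.
intros LS J K.
pose (Q x := Emb lam x /\ x <> identity M).
assert (App : forall x y, Q x -> Q y -> Q (app lam x y)).
{ intros x y [X _] [Y NY]; split; [apply Emb_app; assumption|].
  apply app_nontrivial; auto using Emb_cde. }
enough (H : Q (fib_term (app lam) (S n) j k) /\ Q (fib_term (app lam) (S (S n)) j k))
  by apply H.
induction n as [|n [IH1 IH2]]; [split; assumption|].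
split; [exact IH2|exact (App _ _ IH2 IH1)].
Qed.

(** [t_(n+2)] is the left power of the sequence [t_2, t_1, t_2, t_3, ...]. *)
Lemma fib_term_agree j k : laver_steel lam -> Emb lam j -> Emb lam k ->
  exists n, 1 <= n /\ agree gam (fib_term (app lam) n j k) (identity M).
Proof.
intros LS J K.
(* The Laver-Steel theorem concerns non-trivial embeddings; a trivial [k] or [j] is already the term
   [t_1] or [t_2]. *)
destruct (classic (k = identity M)) as [->|Nk]; [exists 1; split; [lia|apply agree_refl]|].
destruct (classic (j = identity M)) as [->|Nj]; [exists 2; split; [lia|apply agree_refl]|].
pose (t n := fib_term (app lam) n j k).
assert (T : forall n, Emb lam (t (S n)) /\ t (S n) <> identity M).
{ intro n; apply fib_term_nontrivial; auto. }
pose (s n := match n with O => j | S m => t (S m) end).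
assert (E : forall n, left_power lam s n = t (S (S n))).
{ induction n as [|n IH]; [reflexivity|].
  change (app lam (left_power lam s n) (t (S n)) = t (S (S (S n)))).
  rewrite IH; reflexivity. }
assert (C : forall n, is_crit lam (left_power lam s n) (crit lam (left_power lam s n))).
{ intro n; rewrite E; apply crit_spec; [apply Emb_cde|]; apply T. }
assert (Hs : gam ∈ sup_seq (fun n => crit lam (left_power lam s n))).
{ rewrite (LS s); [exact Hgl|]; intros [|n]; [split; assumption|apply T]. }
apply sup_seqP in Hs; [|intro n; apply C].
destruct Hs as [n Hn]; exists (S (S n)); split; [lia|].
specialize (C n); rewrite E in C, Hn.
apply (crit_agree_identity _ _ (Emb_cde _ (proj1 (T (S n)))) C).
exact (proj1 (ord_lam _ (proj1 C)) _ Hn).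
Qed.

End Congruence.

End Embeddings.

(** * Quotients by a congruence *)

Section Quotient.

Context {T : Type} (X : T -> Prop) (R : T -> T -> Prop) (op : T -> T -> T).
Context (Rrefl : forall x, R x x) (Rsym : forall x y, R x y -> R y x)
  (Rtrans : forall x y z, R x y -> R y z -> R x z)
  (opX : forall x y, X x -> X y -> X (op x y))
  (Rop : forall x x' y y', X x -> X x' -> X y -> X y' ->
     R x x' -> R y y' -> R (op x y) (op x' y')).

Lemma eq_class_eq x y : R x y -> eq_class X R x = eq_class X R y.
Proof.
intro H; apply functional_extensionality; intro z.
apply propositional_extensionality; split; intros [Xz Hz]; split; eauto.
Qed.

Lemma eq_class_inj x y : X y -> eq_class X R x = eq_class X R y -> R x y.
Proof. intros Xy E; assert (H : eq_class X R x y) by (rewrite E; split; auto); apply H. Qed.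

Lemma quot_op_class x y : X x -> X y ->
  quot_op X R op (eq_class X R x) (eq_class X R y) = eq_class X R (op x y).
Proof.
intros Xx Xy; apply functional_extensionality; intro z.
apply propositional_extensionality; split.
- intros [Xz (a & b & [Xa Ha] & [Xb Hb] & H)]; split; [exact Xz|]; eauto.
- intros [Xz H]; split; [exact Xz|]; exists x, y; repeat split; auto.
Qed.

Lemma fib_term_quot x y n : X x -> X y ->
  fib_term (quot_op X R op) n (eq_class X R x) (eq_class X R y) =
  eq_class X R (fib_term op n x y).
Proof.
intros Xx Xy; destruct n as [|n]; [reflexivity|].
(* The recursion reaches back two terms, so consecutive terms are treated together; membership in
   [X] is carried along for [quot_op_class]. *)
enough (H : (X (fib_term op (S n) x y) /\ X (fib_term op (S (S n)) x y)) /\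
  fib_term (quot_op X R op) (S n) (eq_class X R x) (eq_class X R y) =
    eq_class X R (fib_term op (S n) x y) /\
  fib_term (quot_op X R op) (S (S n)) (eq_class X R x) (eq_class X R y) =
    eq_class X R (fib_term op (S (S n)) x y)) by apply H.
induction n as [|n [[X1 X2] [E1 E2]]]; [repeat split; auto|].
set (F := fib_term op) in *; set (G := fib_term (quot_op X R op)) in *.
change (F (S (S (S n))) x y) with (op (F (S (S n)) x y) (F (S n) x y)).
change (G (S (S (S n))) (eq_class X R x) (eq_class X R y)) with
  (quot_op X R op (G (S (S n)) (eq_class X R x) (eq_class X R y))
                  (G (S n) (eq_class X R x) (eq_class X R y))).
rewrite E1, E2, quot_op_class by assumption; auto.
Qed.

End Quotient.

(** * The algebra of embeddings up to agreement below [gam] *)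

Theorem proposition2p10 (lam gam : V)
    (hlam : cardinal lam) (hgam : limit_ordinal gam) (hlt : gam ∈ lam)
    (hLS : laver_steel lam) :
  let X := quot (Emb lam) (agree gam) in
  let op := quot_op (Emb lam) (agree gam) (app lam) in
  LD_system X op /\
  permutative X op /\
  (forall C, Li X op C <->
     C = eq_class (Emb lam) (agree gam) (identity (stage lam))).
Proof.
intros X op; pose proof (cardinal_limit lam gam hlam hgam hlt) as Hl.
pose proof (Emb_cde lam Hl) as Ec.
pose proof (agree_refl gam) as Ar; pose proof (agree_sym gam) as As.
pose proof (agree_trans gam) as At.
pose proof (fun j k => Emb_app lam Hl j k hLS) as Ea.
pose (cls := eq_class (Emb lam) (agree gam)).
assert (Op : forall j k, Emb lam j -> Emb lam k -> op (cls j) (cls k) = cls (app lam j k)).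
{ intros j k J K; apply quot_op_class; auto.
  intros; apply agree_app; auto. }
assert (Xcls : forall j, Emb lam j -> X (cls j)) by (intros j J; exists j; auto).
pose proof (identity_Emb lam) as I.
assert (HLi : forall C, Li X op C <-> C = cls (identity (stage lam))).
{ intro C; split.
  - intros [[j [J ->]] H]; apply eq_class_eq; auto.
    (* A left identity is idempotent: its action on its own class says that [j * j] and [j]
       agree. *)
    apply (agree_square lam Hl gam hlt j (Ec j J)).
    apply (eq_class_inj (Emb lam) (agree gam) Ar); [exact J|].
    fold (cls j) in H |- *; fold (cls (app lam j j)).
    rewrite <- Op by assumption; apply H, Xcls, J.
  - intros ->; split; [apply Xcls, I|]; intros D [k [K ->]].
    fold (cls k); rewrite Op, app_identity_l by auto; reflexivity. }
split; [split|split; [split; [split|]|exact HLi]].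
- intros A B [j [J ->]] [k [K ->]].
  fold (cls j) (cls k); rewrite Op by assumption; auto.
- intros A B C [j [J ->]] [k [K ->]] [l [L ->]].
  fold (cls j) (cls k) (cls l); rewrite !Op by auto.
  rewrite app_distributive by auto; reflexivity.
- intros C [HC _]; exact HC.
- intros A B [j [J ->]] HB; apply HLi in HB; subst B; apply HLi.
  fold (cls j); rewrite Op, app_identity_r by auto; reflexivity.
- intros A B [j [J ->]] [k [K ->]].
  destruct (fib_term_agree lam Hl gam hlt j k hLS J K) as (n & Hn & A).
  exists n; split; [exact Hn|]; apply HLi; unfold op.
  rewrite fib_term_quot; auto.
  + apply eq_class_eq; auto.
  + intros; apply agree_app; auto.
Qed.
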